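(* Let $t\mapsto X(t)$ be the continuous-time nearest neighbour random walk on $\mathbb{Z}^d$ in the random environment $(p_k)_{k\in\mathcal{E}}$ described in the context. Assume (all notation as in the context): - (bistochasticity) $\sum_{k\in\mathcal{E}}p_k(\omega)=\sum_{k\in\mathcal{E}}p_{-k}(\tau_k\omega)$ for $\pi$-a.e. $\omega$; - (no drift) $\int_\Omega v_k\,d\pi=0$ for all $k\in\mathcal{E}$; - (ellipticity) there is $s_*\in(0,s^*]$ with $s_k(\omega)\ge s_*$ for $\pi$-a.e. $\omega$ and all $k\in\mathcal{E}$; - ($\mathcal{H}_{-1}$-condition) $\displaystyle\int_{[-\pi,\pi)^d}\Big(\sum_{m=1}^d(1-\cos p_m)\Big)^{-1}\sum_{i=1}^d\widehat C_{ii}(p)\,dp<\infty$. Then for any vector $v\in\mathbb{R}^d$, $$2s_*|v|^2\le\liminf_{t\to\infty}t^{-1}\mathbf{E}\big((v\cdot X(t))^2\big)\le\limsup_{t\to\infty}t^{-1}\mathbf{E}\big((v\cdot X(t))^2\big)\le 6s^*|v|^2+\frac{24}{s_*}\sum_{i,j=1}^d\big(\widetilde C_{ij}+\widetilde D_{ij}\big)v_iv_j.$$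
   Context: Let $(\Omega,\mathcal{F},\pi)$ be a probability space with a measure-preserving ergodic action $(\tau_z)_{z\in\mathbb{Z}^d}$ of $\mathbb{Z}^d$. Let $e_1,\dots,e_d$ be the standard basis of $\mathbb{Z}^d$ and $\mathcal{E}=\{\pm e_1,\dots,\pm e_d\}$. Let $p_k:\Omega\to[0,s^*]$, $k\in\mathcal{E}$, be measurable functions with common bound $s^*<\infty$. Random walk: given $\omega$, $X(t)$ is the continuous-time Markov chain on $\mathbb{Z}^d$ with $X(0)=0$ that jumps from $x$ to $x+k$, $k\in\mathcal{E}$, with rate $p_k(\tau_x\omega)$. $\mathbf{E}_\omega$ denotes expectation over the walk for fixed $\omega$ (quenched), and $\mathbf{E}(\cdot)=\int_\Omega\mathbf{E}_\omega(\cdot)\,d\pi(\omega)$ the annealed expectation. Define $$v_k(\omega)=\tfrac12\big(p_k(\omega)-p_{-k}(\tau_k\omega)\big),\quad s_k(\omega)=\tfrac12\big(p_k(\omega)+p_{-k}(\tau_k\omega)\big),$$ $$\varphi(\omega)=\sum_{k\in\mathcal{E}}k\,v_k(\omega)\in\mathbb{R}^d,\quad \psi(\omega)=\sum_{k\in\mathcal{E}}k\,s_k(\omega)\in\mathbb{R}^d.$$ For $x\in\mathbb{Z}^d$ let $C_{ij}(x)=\int_\Omega\varphi_i(\omega)\varphi_j(\tau_x\omega)\,d\pi(\omega)$ and $D_{ij}(x)=\int_\Omega\psi_i(\omega)\psi_j(\tau_x\omega)\,d\pi(\omega)$. Their Fourier transforms $\widehat C_{ij}(p)=\sum_{x\in\mathbb{Z}^d}e^{\sqrt{-1}x\cdot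 p}C_{ij}(x)$, $\widehat D_{ij}(p)=\sum_{x\in\mathbb{Z}^d}e^{\sqrt{-1}x\cdot p}D_{ij}(x)$ are understood in the sense of distributions on $[-\pi,\pi)^d$; by Herglotz's theorem they are positive definite $d\times d$-matrix valued measures, written $\widehat C_{ij}(p)\,dp$, $\widehat D_{ij}(p)\,dp$ (so $C_{ij}(x)=(2\pi)^{-d}\int e^{-\sqrt{-1}x\cdot p}\,\widehat C_{ij}(p)\,dp$). When there is no drift these measures have no atom at $p=0$. Finally $$\widetilde C_{ij}=\int_{[-\pi,\pi)^d}\Big(\sum_{m=1}^d(1-\cos p_m)\Big)^{-1}\widehat C_{ij}(p)\,dp,\qquad \widetilde D_{ij}=\int_{[-\pi,\pi)^d}\Big(\sum_{m=1}^d(1-\cos p_m)\Big)^{-1}\widehat D_{ij}(p)\,dp.$$ (The matrix $\widetilde D$ is always finite, because $\psi_i(\omega)=s_{e_i}(\omega)-s_{e_i}(\tau_{-e_i}\omega)$; $\widetilde C$ is finite under the $\mathcal{H}_{-1}$-condition.) *)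

(* Defs.v *)
From HB Require Import structures.
From mathcomp Require Import all_boot all_order all_algebra.
From mathcomp Require Import all_classical all_reals all_analysis.
From mathcomp.real_closed Require Import complex.

Set Implicit Arguments.
Unset Strict Implicit.
Unset Printing Implicit Defensive.

Import Order.TTheory GRing.Theory Num.Theory.
Import numFieldNormedType.Exports.

Local Open Scope classical_set_scope.
Local Open Scope ring_scope.

Record ergodic_action (d : nat) (R : realType) (dO : measure_display)
    (Omega : measurableType dO) (mu : probability Omega R)
    (tau : 'rV[int]_d -> Omega -> Omega) : Prop := ErgodicAction {
  action0 : forall w, tau 0 w = w ;
  actionD : forall x y w, tau (x + y) w = tau x (tau y w) ;
  action_measurable : forall x, measurable_fun [set: Omega] (tau x) ;
  action_preserving : forall x A, measurable A -> mu (tau x @^-1` A) = mu A ;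
  action_ergodic : forall A, measurable A ->
    (forall x, tau x @^-1` A = A) -> mu A = 0%E \/ mu A = 1%E }.

(* [(i, true)] stands for the unit vector e_i and [(i, false)] for - e_i. *)
Definition direction (d : nat) : finType := ('I_d * bool)%type.

Definition opp_dir (d : nat) (k : direction d) : direction d := (k.1, ~~ k.2).

Definition step (d : nat) (k : direction d) : 'rV[int]_d :=
  if k.2 then delta_mx 0 k.1 else - delta_mx 0 k.1.

Section Environment.
Context {d : nat} {R : realType} {dO : measure_display}.
Context {Omega : measurableType dO}.
Variables (mu : probability Omega R) (tau : 'rV[int]_d -> Omega -> Omega).
Variable p : direction d -> Omega -> R.

Definition flow (k : direction d) (w : Omega) : R :=
  2^-1 * (p k w - p (opp_dir k) (tau (step k) w)).

Definition conductance (k : direction d) (w : Omega) : R :=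
  2^-1 * (p k w + p (opp_dir k) (tau (step k) w)).

Definition phi (i : 'I_d) (w : Omega) : R :=
  \sum_(k : direction d) (step k 0 i)%:~R * flow k w.

Definition psi (i : 'I_d) (w : Omega) : R :=
  \sum_(k : direction d) (step k 0 i)%:~R * conductance k w.

Definition correlation (f : 'I_d -> Omega -> R) (i j : 'I_d)
    (x : 'rV[int]_d) : R :=
  Rintegral mu [set: Omega] (fun w => f i w * f j (tau x w)).

(* The generator applied to the indicator of [y], evaluated at [x]: off the
   diagonal it is the jump rate from [x] to [y], on the diagonal it is minus
   the total jump rate out of [x]. *)
Definition walk_generator (w : Omega) (x y : 'rV[int]_d) : R :=
  \sum_(k : direction d)
    p k (tau x w) * ((y == x + step k)%:R - (y == x)%:R).

End Environment.

Section MarkovChain.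
Context {R : realType} {S : choiceType}.

Record transition_function (P : R -> S -> S -> R) : Prop :=
  TransitionFunction {
  transition_ge0 : forall t x y, 0 <= t -> 0 <= P t x y ;
  transition_sum1 : forall t x, 0 <= t ->
    (\esum_(y in [set: S]) (P t x y)%:E = 1)%E ;
  transition0 : forall x y, P 0 x y = (x == y)%:R ;
  transitionD : forall s t x y, 0 <= s -> 0 <= t ->
    ((P (s + t) x y)%:E = \esum_(z in [set: S]) (P s x z * P t z y)%:E)%E }.

Definition has_generator (P : R -> S -> S -> R) (Q : S -> S -> R) : Prop :=
  forall x y, h^-1 * (P h x y - (x == y)%:R) @[h --> 0^'+] --> Q x y.

(* The weight P_{t1-t0}(x0,x1) P_{t2-t1}(x1,x2) ... of being at x_i at time t_i,
   starting from x0 at time t0. *)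
Fixpoint path_weight (P : R -> S -> S -> R) (t0 : R) (x0 : S)
    (c : seq (R * S)) : R :=
  if c is (t, x) :: c' then P (t - t0) x0 x * path_weight P t x c' else 1.

(* Under [m], [X] is a right-continuous time-homogeneous Markov chain started
   at [x0] with Q-matrix [Q]; only times [t >= 0] matter. *)
Record markov_chain (dT : measure_display) (T : measurableType dT)
    (m : {measure set T -> \bar R}) (X : R -> T -> S) (x0 : S)
    (Q : S -> S -> R) : Prop := MarkovChain {
  chain_measurable : forall t x, 0 <= t -> measurable (X t @^-1` [set x]) ;
  chain_right_continuous : forall t a, 0 <= t ->
    \forall s \near t^'+, X s a = X t a ;
  chain_law : exists P : R -> S -> S -> R,
    [/\ transition_function P, has_generator P Q &
        forall c : seq (R * S), path <=%R 0 (map fst c) ->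
          m [set a | forall tx, tx \in c -> X tx.1 a = tx.2]
            = (path_weight P 0 x0 c)%:E] }.

End MarkovChain.

(* The law of the walk in the environment [w] is [Pw w]; its measurability in
   [w] is part of being a kernel. *)
Definition random_walk (d : nat) (R : realType) (dO dT : measure_display)
    (Omega : measurableType dO) (T : measurableType dT)
    (tau : 'rV[int]_d -> Omega -> Omega) (p : direction d -> Omega -> R)
    (Pw : R.-pker Omega ~> T) (X : R -> T -> 'rV[int]_d) : Prop :=
  forall w, markov_chain (Pw w) X 0 (walk_generator tau p w).

Definition annealed (R : realType) (dO dT : measure_display)
    (Omega : measurableType dO) (T : measurableType dT)
    (mu : probability Omega R) (Pw : R.-pker Omega ~> T) (f : T -> R) : \bar R :=
  (\int[mu]_w \int[Pw w]_a (f a)%:E)%E.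

Definition dotZ (d : nat) (R : realType) (v : 'rV[R]_d) (x : 'rV[int]_d) : R :=
  \sum_(i < d) v 0 i * (x 0 i)%:~R.

Section ComplexMeasure.
Context {R : realType} {dT : measure_display} {T : measurableType dT}.

Record complex_measure := ComplexMeasure {
  re_part : {charge set T -> \bar R} ;
  im_part : {charge set T -> \bar R} }.

Definition complex_measure_val (M : complex_measure) (A : set T) : R[i] :=
  Complex (fine (re_part M A)) (fine (im_part M A)).

(* Integration over [D] against a signed measure, through its Jordan
   decomposition. *)
Definition charge_integral (nu : {charge set T -> \bar R}) (D : set T)
    (f : T -> \bar R) : \bar R :=
  let hP := cid (Hahn_decomposition nu) in
  let hN := cid (projT2 hP) in
  (\int[jordan_pos (projT2 hN)]_(x in D) f x
   - \int[jordan_neg (projT2 hN)]_(x in D) f x)%E.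

Definition charge_Rintegral (nu : {charge set T -> \bar R}) (D : set T)
    (f : T -> R) : R :=
  fine (charge_integral nu D (EFin \o f)).

Definition complex_integral (M : complex_measure) (D : set T)
    (f : T -> R[i]) : R[i] :=
  let re x := complex.Re (f x) in
  let im x := complex.Im (f x) in
  Complex
    (charge_Rintegral (re_part M) D re - charge_Rintegral (im_part M) D im)
    (charge_Rintegral (re_part M) D im + charge_Rintegral (im_part M) D re).

End ComplexMeasure.
Arguments complex_measure R {dT} T.

Section Spectral.
Context {d : nat} {R : realType}.

Definition torus : set (d.-tuple R) :=
  [set q | forall i, - pi <= tnth q i < pi].

(* exp (- sqrt(-1) x.q) *)
Definition character (x : 'rV[int]_d) (q : d.-tuple R) : R[i] :=
  let a := \sum_(i < d) (x 0 i)%:~R * tnth q i in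
  Complex (cos a) (- sin a).

(* [M] is the Fourier transform of [C], that is, the matrix-valued measure
   with density sum_x exp (sqrt(-1) x.q) C(x) in the sense of distributions:
   the positive semidefinite one, carried by the torus, with Fourier
   coefficients [C].  Herglotz's theorem gives its existence for
   positive-definite [C]; it is unique. *)
Record spectral_measure (C : 'I_d -> 'I_d -> 'rV[int]_d -> R)
    (M : 'I_d -> 'I_d -> complex_measure R (d.-tuple R)) : Prop :=
  SpectralMeasure {
  spectral_carrier : forall i j A, measurable A -> A `&` torus = set0 ->
    complex_measure_val (M i j) A = 0 ;
  spectral_psd : forall A (z : 'I_d -> R[i]), measurable A ->
    0 <= \sum_(i < d) \sum_(j < d)
           z i * conjc (z j) * complex_measure_val (M i j) A ;
  spectral_inversion : forall i j x,
    Complex (C i j x) 0 =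
      Complex ((2 * pi) ^- d) 0 * complex_integral (M i j) torus (character x) }.

(* The inverse is that of \bar R, so the value at q = 0 is +oo. *)
Definition inv_laplacian (q : d.-tuple R) : \bar R :=
  ((\sum_(m < d) (1 - cos (tnth q m)))%:E^-1)%E.

(* The integral of [inv_laplacian] against [M i j].  The correlations being
   real, the imaginary part of [M i j] is odd under q -> - q modulo 2 pi, while
   [inv_laplacian] is even: only the real part contributes. *)
Definition tilde (M : 'I_d -> 'I_d -> complex_measure R (d.-tuple R))
    (i j : 'I_d) : \bar R :=
  charge_integral (re_part (M i j)) torus inv_laplacian.

End Spectral.

(* Main.v *)
(** Uniformization: a transition function with bounded rates Q dominates the
    Poisson mixture of the powers of 1 + Q / L (a Dini derivative argument), and
    equals it since both have total mass one.  On (v.x)^2 these powers take the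
    form (v.x)^2 + 2 (v.x) h_n(tau_x w) + c_n(tau_x w), so that the annealed
    second moment is a Poisson average of the E c_n.

    By bistochasticity the environment seen from the walk is stationary, which
    makes the recursion for E c_n explicit.  The increment of E (c_n - h_n^2) is,
    up to a factor 1 + O(1/L), the energy
    E sum_k p_k (v.k + h_n o tau_k - h_n)^2 / L, which is at least
    2 s_low |v|^2 / L; the lower bound follows as L goes to infinity.  The
    increment of E (c_n + h_n^2) is controlled by 4 <v.phi, h_n> - D(h_n) with D
    the Dirichlet form, and is bounded through <v.phi, h>^2 <= N D(h), where N is
    a multiple of the quadratic form of C tilde.

    This inequality needs no spectral theorem.  For the lazy kernel
    K = 1 - c sum_k (1 - tau_k), with Fourier symbol kappa in [0, 1], the numbers
    <v.phi, K^n (v.phi)> are the integrals of kappa^n against the spectral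
    measure; their sum is the H_{-1} norm, because the sum of kappa^n is
    1 / (1 - kappa), and it bounds <v.phi, h>^2 / <h, (1 - K) h>.  The same
    argument read backwards shows that D tilde is finite, psi being a gradient. *)

Require Import Defs.
From HB Require Import structures.
From mathcomp Require Import all_boot all_order all_algebra.
From mathcomp Require Import all_classical all_reals all_analysis.
From mathcomp.real_closed Require Import complex.
From mathcomp Require Import measurable_realfun.
From mathcomp Require Import ring lra.

Set Implicit Arguments.
Unset Strict Implicit.
Unset Printing Implicit Defensive.

Import Order.TTheory GRing.Theory Num.Theory.
Import numFieldNormedType.Exports.

Local Open Scope classical_set_scope.
Local Open Scope ring_scope.

(** * Uniformization of Markov chains with bounded rates *)

(** The recursion for E c_n contains the pairing of h_n with the local drift, which has no sign.
    Combining with E h_n^2 disposes of it in two ways. The function c_n - h_n^2 is the quenched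
    variance of the uniformized chain, and subtracting completes the square of the jump increment.
    In c_n + h_n^2 the drift pairings cancel, and what remains is the pairing with v.phi together
    with a dissipation term. The rate L is a free parameter above the total jump rate. The second
    moment at time t does not depend on it, so each bound picks its own L and holds at every t > 0,
    before any limit in t. The inverse of 1 - K need not be defined at v.phi, so only the finite
    sums of K^j (v.phi) are used. Laziness makes K nonnegative as a form; the autocorrelations are
    then nonnegative, and partial sums are bounded by their limit. *)

(** One-sided estimates replace differentiability and continuity, because Chapman-Kolmogorov yields
    only inequalities of this kind. The left estimate carries the bound to the supremum of the good
    times, and the right one pushes it beyond. *)
Lemma dini_ge0_le (R : realType) (g : R -> R) (T : R) : 0 <= T ->
  (forall t e, 0 <= t -> 0 < e ->
    \forall h \near 0^'+, g t - e * h <= g (t + h)) ->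
  (forall t e, 0 < t -> 0 < e -> \forall h \near 0^'+, g (t - h) <= g t + e) ->
  g 0 <= g T.
Proof.
move=> T0 right left.
apply/ler_addgt0Pr => e0 e0_gt0; set e := e0 / (T + 1).
have e_gt0 : 0 < e by rewrite divr_gt0// ltr_wpDl.
suff main : g 0 - e * T <= g T.
  have eT : e * T <= e0.
    by rewrite /e mulrAC ler_pdivrMr ?ltr_wpDl// mulrDr mulr1 lerDl ltW.
  by rewrite -lerBlDr (le_trans _ main)// lerD2l lerN2.
pose A := [set t : R | 0 <= t <= T /\
  forall s, 0 <= s <= t -> g 0 - e * s <= g s].
have A0 : A 0.
  split; first by rewrite lexx.
  by move=> s /le_anti <-; rewrite mulr0 subr0.
have supA : has_sup A by split; [exists 0 | exists T => t [/andP[]]].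
set u := sup A.
have u0 : 0 <= u by apply: sup_upper_bound.
have uT : u <= T by apply: ge_sup; [exists 0 | move=> t [/andP[]]].
have below s : 0 <= s < u -> g 0 - e * s <= g s.
  move=> /andP[s0 su]; have [t [_ tP]] : exists2 t, A t & s < t.
    have [|t At] := @sup_adherent _ A (u - s) _ supA; first by rewrite subr_gt0.
    by rewrite -/u subKr => st; exists t.
  by move=> /ltW st; apply: tP; rewrite s0.
have gu : g 0 - e * u <= g u.
  have [u_eq0|u_neq0] := eqVneq u 0; first by rewrite u_eq0 mulr0 subr0.
  have u_gt0 : 0 < u by rewrite lt_neqAle eq_sym u_neq0.
  apply/ler_addgt0Pr => e' e'_gt0.
  near (0 : R)^'+ => h.
  have h_gt0 : 0 < h by near: h; exact: nbhs_right_gt.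
  have hu : h < u by near: h; exact: nbhs_right_lt.
  have le1 : g (u - h) <= g u + e'.
    by near: h; apply: left.
  apply: le_trans le1; apply: le_trans (below (u - h) _).
    by rewrite lerD2l lerN2 ler_wpM2l ?(ltW e_gt0)// lerBlDr lerDl ltW.
  by rewrite subr_ge0 ltW//= ltrBlDr ltrDl.
have Au : A u.
  split; first by rewrite u0.
  move=> s /andP[s0]; rewrite le_eqVlt => /predU1P[->//|su].
  by apply: below; rewrite s0.
have [uTe|uneqT] := eqVneq u T; first by rewrite -uTe.
have uT' : u < T by rewrite lt_neqAle uneqT.
exfalso.
have [d /= d0 dP] := right _ _ u0 e_gt0.
have [h /andP[h0 hP]] : exists h, 0 < h < Num.min d (T - u).
  have m0 : 0 < Num.min d (T - u) by rewrite lt_min d0 subr_gt0.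
  by exists (Num.min d (T - u) / 2); lra.
move: hP; rewrite lt_min => /andP[hd hT].
have : A (u + h).
  split; first by rewrite addr_ge0 ?(ltW h0)//= addrC -lerBrDr ltW.
  move=> s /andP[s0 sh]; have [su|us] := leP s u; first by apply: Au.2; rewrite s0.
  have sh0 : 0 < s - u by rewrite subr_gt0.
  have := dP (s - u); rewrite /= sub0r normrN gtr0_norm// => /(_ _ sh0).
  rewrite addrCA subrr addr0 => H; apply: le_trans (H _).
    by move: gu; lra.
  by rewrite (le_lt_trans _ hd)// lerBlDl.
move=> /(sup_upper_bound supA); rewrite -/u gerDl leNgt h0//.
Unshelve. all: by end_near. Qed.

Lemma is_derive_cvg_right (R : realType) (f : R -> R) (t D : R) :
  is_derive t 1 f D -> h^-1 * (f (t + h) - f t) @[h --> 0^'+] --> D.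
Proof.
move=> [fd fD]; apply: cvg_dnbhs_at_right; rewrite -fD.
have -> : (fun h => h^-1 * (f (t + h) - f t)) =
    (fun h => h^-1 *: ((f \o shift t) (h *: 1) - f t)).
  by apply/funext => h /=; rewrite [h *: 1]mulr1 [t + h]addrC.
exact: fd.
Qed.

Section JumpChain.
Context {R : realType} {S : choiceType} {I : finType}.
Variables (r : I -> S -> R) (s : I -> S -> S) (L : R).

Definition jump_generator (x y : S) : R :=
  \sum_k r k x * ((y == s k x)%:R - (y == x)%:R).

Definition jump_kernel (f : S -> R) (x : S) : R :=
  f x + L^-1 * \sum_k r k x * (f (s k x) - f x).

Definition exp_poly (f : S -> R) (N : nat) (t : R) (x : S) : R :=
  \sum_(n < N) (L * t) ^+ n / n`!%:R * iter n jump_kernel f x.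

Hypothesis r_ge0 : forall k x, 0 <= r k x.
Hypothesis L_gt0 : 0 < L.
Hypothesis r_le : forall x, \sum_k r k x <= L.

(** All weights are nonnegative once L dominates the total rate; monotonicity and positivity of the
    kernel are read off from this form. *)
Lemma jump_kernelE (f : S -> R) x : jump_kernel f x =
  (1 - L^-1 * \sum_k r k x) * f x + \sum_k L^-1 * r k x * f (s k x).
Proof.
rewrite /jump_kernel mulrBl mul1r -addrA -mulrA mulr_suml; congr (_ + _).
rewrite 2!mulr_sumr -sumrN -big_split /=.
by apply: eq_bigr => k _; ring.
Qed.

Lemma jump_kernel_stay x : 0 <= 1 - L^-1 * \sum_k r k x.
Proof. by rewrite subr_ge0 mulrC ler_pdivrMr// mul1r. Qed.

Lemma jump_kernel_le (f g : S -> R) x :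
  (forall z, f z <= g z) -> jump_kernel f x <= jump_kernel g x.
Proof.
move=> fg; rewrite !jump_kernelE lerD ?ler_wpM2l ?jump_kernel_stay//.
by apply: ler_sum => k _; rewrite ler_wpM2l// mulr_ge0// invr_ge0 ltW.
Qed.

Lemma jump_kernelZ (a : R) (f : S -> R) x :
  jump_kernel (fun z => a * f z) x = a * jump_kernel f x.
Proof.
rewrite !jump_kernelE mulrDr; congr (_ + _); first by ring.
by rewrite mulr_sumr; apply: eq_bigr => k _; ring.
Qed.

Lemma iter_jump_kernel_ge0 (f : S -> R) n x :
  (forall z, 0 <= f z) -> 0 <= iter n jump_kernel f x.
Proof.
move=> f0; elim: n x => [|n IHn] x //=.
have := @jump_kernel_le (fun=> 0) _ x IHn.
by rewrite /jump_kernel subr0 big1 ?mulr0 ?addr0// => k _; rewrite mulr0.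
Qed.

Lemma exp_polyS (f : S -> R) N t x : exp_poly f N.+1 t x =
  exp_poly f N t x + (L * t) ^+ N / N`!%:R * iter N jump_kernel f x.
Proof. by rewrite /exp_poly big_ord_recr. Qed.

Lemma exp_poly0 (f : S -> R) N x : exp_poly f N.+1 0 x = f x.
Proof.
rewrite /exp_poly big_ord_recl big1 ?addr0 /=.
  by rewrite expr0 fact0 divr1 mul1r.
by move=> i _; rewrite mulr0 expr0n /= mul0r mul0r.
Qed.

(** Differentiation lowers the truncation order by one, so that the derivative at one order is
    controlled by the inequality at the previous order. *)
Lemma is_derive_exp_poly (f : S -> R) N (t : R) x :
  is_derive t (1 : R) (fun u : R => exp_poly f N.+1 u x) (L * jump_kernel (exp_poly f N t) x).
Proof.
elim: N => [|N IHN].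
  have -> : (fun u => exp_poly f 1 u x) = cst (f x).
    by apply/funext => u; rewrite /exp_poly big_ord1 expr0 fact0 divr1 mul1r.
  have -> : L * jump_kernel (exp_poly f 0 t) x = 0.
    rewrite /jump_kernel /exp_poly big_ord0 add0r big1 ?mulr0//.
    by move=> k _; rewrite !big_ord0 subr0 mulr0.
  exact: is_derive_cst.
have -> : (fun u => exp_poly f N.+2 u x) = (fun u => exp_poly f N.+1 u x) +
    (fun u => L ^+ N.+1 / N.+1`!%:R * iter N.+1 jump_kernel f x *: (id ^+ N.+1 : R -> R) u).
  apply/funext => u; rewrite exp_polyS; congr (_ + _).
  by rewrite exprMn /GRing.scale /= fctE; ring.
apply: is_derive_eq.
rewrite [in RHS](_ : exp_poly f N.+1 t = fun z => exp_poly f N t z +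
   (L * t) ^+ N / N`!%:R * iter N jump_kernel f z); last first.
  by apply/funext => z; rewrite exp_polyS.
have -> (g h : S -> R) : jump_kernel (fun z => g z + h z) x = jump_kernel g x + jump_kernel h x.
  rewrite !jump_kernelE mulrDr addrACA; congr (_ + _).
  by rewrite -big_split; apply: eq_bigr => k _; rewrite mulrDr.
rewrite [RHS]mulrDr; congr (_ + _).
rewrite jump_kernelZ /GRing.scale /= factS natrM exprS exprMn.
have N0 : N.+1%:R != 0 :> R by rewrite pnatr_eq0.
have F0 : N`!%:R != 0 :> R by rewrite pnatr_eq0 -lt0n fact_gt0.
move: N0 F0; set a := N.+1%:R; set b := N`!%:R => a0 b0.
by field; apply/andP.
Qed.

Variable P : R -> S -> S -> R.
Hypothesis P_trans : transition_function P.

Lemma sum_le_esum (nb : seq S) (a : S -> R) : uniq nb -> (forall z, 0 <= a z) ->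
  ((\sum_(z <- nb) a z)%:E <= \esum_(z in [set: S]) (a z)%:E)%E.
Proof.
move=> nb_uniq a0; apply: esum_ge; exists [set` nb]; first by split.
by rewrite -fsbig_seq// sumEFin.
Qed.

(** Restricting the intermediate state to a finite list costs the equality, but lets the entrywise
    limits of [has_generator] be summed term by term. *)
Lemma transitionD_ge (nb : seq S) u t x y : uniq nb -> 0 <= u -> 0 <= t ->
  \sum_(z <- nb) P u x z * P t z y <= P (u + t) x y.
Proof.
move=> nb_uniq u0 t0; rewrite -lee_fin (transitionD P_trans)//.
by apply: sum_le_esum => // z; rewrite mulr_ge0 ?(transition_ge0 P_trans).
Qed.

Lemma transition_le1 t x y : 0 <= t -> P t x y <= 1.
Proof.
move=> t0; rewrite -lee_fin -(transition_sum1 P_trans x t0).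
have -> : P t x y = \sum_(z <- [:: y]) P t x z by rewrite big_seq1.
by apply: sum_le_esum => // z; rewrite (transition_ge0 P_trans).
Qed.

End JumpChain.

Lemma near_cvg (T : Type) (U : topologicalType) (F : set_system T) (f g : T -> U)
  (l : U) {FF : Filter F} : f @ F --> l -> (\forall x \near F, f x = g x) -> g @ F --> l.
Proof.
by move=> fl gf; refine (cvg_trans _ fl); exact: near_eq_cvg.
Qed.

Section PoissonRepresentation.
Context {R : realType} {S : choiceType} {I : finType}.
Variables (r : I -> S -> R) (s : I -> S -> S) (L : R).
Hypothesis r_ge0 : forall k x, 0 <= r k x.
Hypothesis L_gt0 : 0 < L.
Hypothesis r_le : forall x, \sum_k r k x <= L.
Variable P : R -> S -> S -> R.
Hypothesis P_trans : transition_function P.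
Hypothesis P_gen : has_generator P (jump_generator r s).

Lemma sum_jump_generator (nb : seq S) (u : S -> R) x : uniq nb -> x \in nb ->
  (forall k, s k x \in nb) ->
  \sum_(z <- nb) jump_generator r s x z * u z = \sum_k r k x * (u (s k x) - u x).
Proof.
move=> nb_uniq xnb snb.
have sum1 y : y \in nb -> \sum_(z <- nb) (z == y)%:R * u z = u y.
  move=> ynb; rewrite (big_rem y)//= eqxx mul1r big1_seq ?addr0// => z /andP[_].
  by rewrite mem_rem_uniq// inE => /andP[/negPf -> _]; rewrite mul0r.
rewrite /jump_generator; under eq_bigr do rewrite mulr_suml.
rewrite exchange_big /=; apply: eq_bigr => k _.
rewrite -(sum1 (s k x))// -(sum1 x)// -sumrB mulr_sumr.
by apply: eq_bigr => z _; ring.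
Qed.

Lemma transition_diag_cvg x : P h x x @[h --> 0^'+] --> (1 : R).
Proof.
have h0 : (fun h : R => h) @ 0^'+ --> (0 : R).
  by apply: (@cvg_at_right_filter R R (fun h => h) 0 0); exact: cvg_id.
have -> : (1 : R) = 0 * jump_generator r s x x + 1 by rewrite mul0r add0r.
refine (near_cvg (cvgD (cvgM h0 (P_gen (x := x) (y := x))) (cvg_cst (1 : R))) _); near=> h => /=.
have hn0 : h != 0 by rewrite gt_eqF//; near: h; exact: nbhs_right_gt.
change (h * (h^-1 * (P h x x - (x == x)%:R)) + 1 = P h x x).
by rewrite eqxx mulrA mulfV// mul1r subrK.
Unshelve. all: by end_near. Qed.

(** Induction on N. The difference [g] of the two sides has lower right derivative at least L times
    the kernel applied to the difference of order N, which is nonnegative by induction;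
    [dini_ge0_le] integrates this from g 0 = 0. *)
Lemma exp_transition_ge N y t x : 0 <= t ->
  exp_poly r s L (fun z => (z == y)%:R) N t x <= expR (L * t) * P t x y.
Proof.
elim: N t x => [|N IHN] T x T0.
  by rewrite /exp_poly big_ord0 mulr_ge0 ?expR_ge0 ?(transition_ge0 P_trans).
set f := fun z : S => (z == y)%:R : R.
pose g t := expR (L * t) * P t x y - exp_poly r s L f N.+1 t x.
have dexp t : is_derive t (1 : R) (fun u : R => expR (L * u)) (L * expR (L * t)).
  have dL : is_derive t (1 : R) (L \*: (id : R -> R)) L.
    by apply: is_derive_eq; rewrite /GRing.scale /= mulr1.
  by have := is_derive1_comp (is_derive_expR (L * t)) dL; rewrite mulrC.
have g0 : g 0 = 0.
  by rewrite /g exp_poly0 mulr0 expR0 mul1r (transition0 P_trans) subrr.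
rewrite -subr_ge0 -[X in X <= _]g0; apply: dini_ge0_le => //.
  move=> t e t0 e0; pose u z := P t z y.
  pose nb := undup (x :: [seq s k x | k <- enum I]).
  have nb_uniq : uniq nb by exact: undup_uniq.
  have xnb : x \in nb by rewrite mem_undup mem_head.
  have snb k : s k x \in nb.
    by rewrite mem_undup inE; apply/orP; right; apply: map_f; rewrite mem_enum.
  (* Keeping only x and its jump targets as states at time h bounds [g (t + h)] below by [G h],
     which does have a right derivative at h = 0. *)
  pose G h := expR (L * (t + h)) * (\sum_(z <- nb) P h x z * u z)
              - exp_poly r s L f N.+1 (t + h) x.
  have cvgG : h^-1 * (G h - g t) @[h --> 0^'+] -->
     expR (L * t) * (\sum_(z <- nb) jump_generator r s x z * u z)
     + u x * (L * expR (L * t)) - L * jump_kernel r s L (exp_poly r s L f N t) x.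
    have c1 : expR (L * (t + h)) @[h --> 0^'+] --> expR (L * t).
      apply: cvg_at_right_filter.
      rewrite -[X in _ --> expR (L * X)](addr0 t).
      apply: (@continuous_comp _ _ _ (fun h => L * (t + h)) expR); last exact: continuous_expR.
      by apply: cvgM; [exact: cvg_cst|apply: cvgD; [exact: cvg_cst|exact: cvg_id]].
    have c2 : \sum_(z <- nb) (h^-1 * (P h x z - (x == z)%:R)) * u z @[h --> 0^'+] -->
        \sum_(z <- nb) jump_generator r s x z * u z.
      elim: (nb) => [|z l IHl].
        by under eq_fun do rewrite big_nil; rewrite big_nil; exact: cvg_cst.
      under eq_fun do rewrite big_cons; rewrite big_cons.
      by apply: cvgD IHl; apply: cvgM; [exact: P_gen|exact: cvg_cst].
    have c4 := is_derive_cvg_right (is_derive_exp_poly r s L f N t x).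
    refine (near_cvg (cvgB (cvgD (cvgM c1 c2) (cvgM (cvg_cst (u x)) (is_derive_cvg_right (dexp t)))) c4) _); near=> h.
    change (expR (L * (t + h)) * \sum_(z <- nb) h^-1 * (P h x z - (x == z)%:R) * u z
      + u x * (h^-1 * (expR (L * (t + h)) - expR (L * t)))
      - h^-1 * (exp_poly r s L f N.+1 (t + h) x - exp_poly r s L f N.+1 t x) =
      h^-1 * (G h - g t)).
    have -> : \sum_(z <- nb) h^-1 * (P h x z - (x == z)%:R) * u z =
       h^-1 * (\sum_(z <- nb) P h x z * u z - u x).
      have -> : u x = \sum_(z <- nb) (x == z)%:R * u z.
        rewrite (big_rem x)//= eqxx mul1r big1_seq ?addr0// => z /andP[_].
        by rewrite mem_rem_uniq// inE eq_sym => /andP[/negPf -> _]; rewrite mul0r.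
      by rewrite -sumrB mulr_sumr; apply: eq_bigr => z _; ring.
    rewrite /G /g -/(u x) /=; ring.
  have lim_ge0 : 0 <= expR (L * t) * (\sum_(z <- nb) jump_generator r s x z * u z)
     + u x * (L * expR (L * t)) - L * jump_kernel r s L (exp_poly r s L f N t) x.
    rewrite sum_jump_generator// subr_ge0.
    have -> : expR (L * t) * (\sum_k r k x * (u (s k x) - u x)) +
        u x * (L * expR (L * t)) = L * jump_kernel r s L (fun z => expR (L * t) * u z) x.
      rewrite jump_kernelZ /jump_kernel.
      by set q := \sum_(k : I) r k x * (u (s k x) - u x); field; rewrite gt_eqF.
    rewrite ler_pM2l//; apply: jump_kernel_le => // z; exact: IHN.
  have nearG : \forall h \near 0^'+, - e < h^-1 * (G h - g t).
    by apply: (cvgr_gt _ cvgG); rewrite (lt_le_trans _ lim_ge0)// oppr_lt0.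
  near=> h.
  have h0 : 0 < h by near: h; exact: nbhs_right_gt.
  have : - e < h^-1 * (G h - g t) by near: h; exact: nearG.
  rewrite mulrC ltr_pdivlMr// => Gh.
  apply: (@le_trans _ _ (G h)); first lra.
  rewrite lerD2r ler_pM2l ?expR_gt0//= [t + h]addrC.
  exact: transitionD_ge (ltW h0) t0.
move=> t e t0 e0.
(* The cost of waiting at x for a time h: P t x y is at least P h x x times P (t - h) x y, and P h x
   x tends to 1. *)
pose E h := expR (L * t) * (1 - P h x x) + (exp_poly r s L f N.+1 t x - exp_poly r s L f N.+1 (t - h) x).
have cvgE : E h @[h --> 0^'+] --> (0 : R).
  have c4 : exp_poly r s L f N.+1 (t - h) x @[h --> 0^'+] --> exp_poly r s L f N.+1 t x.
    apply: cvg_at_right_filter.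
    rewrite -[X in _ --> exp_poly _ _ _ _ _ X _](subr0 t).
    apply: (@continuous_comp _ _ _ (fun h => t - h) (fun u : R => exp_poly r s L f N.+1 u x)).
      by apply: cvgB; [exact: cvg_cst|exact: cvg_id].
    apply/differentiable_continuous/derivable1_diffP.
    by have [] := is_derive_exp_poly r s L f N (t - 0) x.
  have lim0 : expR (L * t) * (1 - 1)
      + (exp_poly r s L f N.+1 t x - exp_poly r s L f N.+1 t x) = 0.
    by rewrite !subrr mulr0 addr0.
  rewrite -[X in _ --> X]lim0.
  exact: (cvgD (cvgM (cvg_cst (expR (L * t)))
    (cvgB (cvg_cst (1 : R)) (transition_diag_cvg x)))
    (cvgB (cvg_cst (exp_poly r s L f N.+1 t x)) c4)).
have nearE : \forall h \near 0^'+, E h < e by exact: (cvgr_lt _ cvgE).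
near=> h.
have h0 : 0 < h by near: h; exact: nbhs_right_gt.
have ht : h < t by near: h; exact: nbhs_right_lt.
have Eh : E h < e by near: h; exact: nearE.
have th0 : 0 <= t - h by rewrite subr_ge0 ltW.
have hP : P h x x * P (t - h) x y <= P t x y.
  have := @transitionD_ge _ _ _ P_trans [:: x] h (t - h) x y isT (ltW h0) th0.
  by rewrite big_seq1 [h + _]addrC subrK.
apply: le_trans (_ : g t + E h <= _); last by rewrite lerD2l ltW.
rewrite /g /E.
have := transition_le1 P_trans x y th0.
have := transition_ge0 P_trans x y th0.
have := transition_le1 P_trans x x (ltW h0).
have : expR (L * (t - h)) <= expR (L * t) by rewrite ler_expR ler_pM2l// gerBl ltW.
have := expR_gt0 (L * (t - h)).
set a := expR _; set b := expR _; set c := P h x x; set d := P (t - h) x y.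
move: hP; rewrite -/c -/d; set q := P t x y; move=> cdq a0 ab c1 d0 d1.
have b0 : 0 < b by exact: lt_le_trans ab.
suff : a * d <= b * q + b * (1 - c) by lra.
apply: le_trans (_ : b * d <= _); first by rewrite ler_wpM2r.
rewrite -mulrDr ler_pM2l//.
have : (1 - c) * d <= (1 - c) * 1 by rewrite ler_wpM2l// subr_ge0.
lra.
Unshelve. all: by end_near. Qed.

End PoissonRepresentation.

(** * Sums of nonnegative extended reals *)

Section ExtendedSums.
Local Open Scope ereal_scope.

Lemma esumZl (R : realType) (S : choiceType) (A : set S) (c : R) (a : S -> \bar R) :
  (0 <= c)%R -> (forall i, 0 <= a i) ->
  \esum_(i in A) (c%:E * a i) = c%:E * \esum_(i in A) a i.
Proof.
have le (c' : R) (a' : S -> \bar R) : (0 <= c')%R -> (forall i, 0 <= a' i) ->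
    \esum_(i in A) (c'%:E * a' i) <= c'%:E * \esum_(i in A) a' i.
  move=> c0 a0; apply: ge_ereal_sup => _ [X [finX XA] <-].
  rewrite -ge0_mule_fsumr// lee_wpmul2l ?lee_fin//.
  by apply: esum_ge; exists X.
rewrite le_eqVlt => /predU1P[<-|c0] a0.
  by rewrite mul0e esum1// => i _; rewrite mul0e.
apply/eqP; rewrite eq_le le ?(ltW c0)//=.
have cVK x : x = (c^-1%R)%:E * (c%:E * x) :> \bar R.
  by rewrite muleA -EFinM mulVf ?gt_eqF// mul1e.
have cKV x : x = c%:E * ((c^-1%R)%:E * x) :> \bar R.
  by rewrite muleA -EFinM mulfV ?gt_eqF// mul1e.
rewrite [leRHS]cKV lee_wpmul2l ?lee_fin ?(ltW c0)//.
under eq_esum do rewrite [a _]cVK.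
apply: le; first by rewrite invr_ge0 ltW.
by move=> i; rewrite mule_ge0// lee_fin ltW.
Qed.

Lemma exchange_esum (R : realType) (S S' : choiceType) (a : S -> S' -> \bar R) :
  (forall i j, 0 <= a i j) ->
  \esum_(i in [set: S]) \esum_(j in [set: S']) a i j =
  \esum_(j in [set: S']) \esum_(i in [set: S]) a i j.
Proof.
move=> a0; rewrite !esum_esum//.
rewrite (@reindex_esum _ _ _ ([set: S'] `*`` (fun=> [set: S])) _ (fun z => (z.2, z.1)))//.
split => // [[i j] [i' j'] _ _ /= [-> ->] //|[i j] _].
by exists (j, i).
Qed.

Lemma esum_delta (R : realType) (S : choiceType) (x : S) (F : S -> R) :
  (forall z, (0 <= F z)%R) ->
  \esum_(y in [set: S]) ((x == y)%:R * F y)%:E = (F x)%:E.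
Proof.
move=> F0; rewrite (esumID [set x]); last first.
  by move=> y _; rewrite lee_fin mulr_ge0.
rewrite setTI esum_set1; last by rewrite lee_fin mulr_ge0.
rewrite eqxx mul1r esum1 ?adde0// => y [_ /= yx].
by rewrite (_ : (x == y) = false) ?mul0r//; apply/eqP => xy; apply: yx.
Qed.

(** Since the common sum is finite, the nonnegative differences sum to 0. This is what turns
    domination of the Poisson mixture by the transition function into equality. *)
Lemma esum_eq_pointwise (R : realType) (S : choiceType) (a b : S -> R) (c : R) :
  (forall z, 0 <= a z <= b z)%R ->
  \esum_(z in [set: S]) (a z)%:E = c%:E -> \esum_(z in [set: S]) (b z)%:E = c%:E ->
  forall z, a z = b z.
Proof.
move=> ab suma sumb z.
have : \esum_(z in [set: S]) (b z)%:E =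
    \esum_(z in [set: S]) (a z)%:E + \esum_(z in [set: S]) (b z - a z)%:E.
  rewrite -esumD; first by apply: eq_esum => i _; rewrite -EFinD addrC subrK.
    by move=> i _; rewrite lee_fin; have /andP[] := ab i.
  by move=> i _; rewrite lee_fin subr_ge0; have /andP[] := ab i.
rewrite suma sumb; set D := esum _ _ => cD.
have D0 : D = 0.
  by case: D cD => //= x [] cx; congr EFin; apply: (addrI c); rewrite addr0.
have : (b z - a z)%:E <= D.
  apply: esum_ge; exists [set z]; first by split.
  by rewrite fsbig_set1.
rewrite D0 lee_fin subr_le0 => ba; apply/eqP.
by rewrite eq_le ba andbT; have /andP[] := ab z.
Qed.

End ExtendedSums.

(** * Poisson weights *)

Definition poisson (R : realType) (m : R) (n : nat) : R :=
  expR (- m) * (m ^+ n / n`!%:R).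

Section Poisson.
Context {R : realType}.
Variable m : R.
Hypothesis m_ge0 : 0 <= m.

Lemma poisson_ge0 n : 0 <= poisson m n.
Proof. by rewrite /poisson !mulr_ge0 ?expR_ge0 ?exprn_ge0 ?invr_ge0. Qed.

Lemma poisson_sum1 : (\sum_(n <oo) (poisson m n)%:E = 1)%E.
Proof.
have -> : (1 = (expR (- m))%:E * (expR m)%:E :> \bar R)%E.
  by rewrite -EFinM expRN mulVf ?gt_eqF ?expR_gt0.
have -> : (expR m)%:E = (\sum_(n <oo) (m ^+ n / n`!%:R)%:E)%E.
  rewrite /expR -EFin_lim; last exact: is_cvg_series_exp_coeff.
  by apply: congr_lim; apply/funext => N /=; rewrite /series /= sumEFin.
rewrite -nneseriesZl; first by apply: eq_eseriesr => n _; rewrite -EFinM.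
by move=> n _; rewrite lee_fin divr_ge0 ?exprn_ge0.
Qed.

(** Each term is m times the preceding Poisson weight, so the series is m times the total mass. *)
Lemma poisson_mean : (\sum_(n <oo) (n%:R * poisson m n)%:E = m%:E)%E.
Proof.
rewrite nneseries_recl//; last by move=> n _; rewrite lee_fin mulr_ge0 ?poisson_ge0.
rewrite mul0r add0e -[RHS]mule1 -poisson_sum1 -nneseriesZl; last first.
  by move=> n _; rewrite lee_fin poisson_ge0.
rewrite -nneseries_addn; last by move=> n; rewrite lee_fin mulr_ge0 ?poisson_ge0.
apply: eq_eseriesr => n _; rewrite -EFinM addn1 /poisson factS natrM exprS; congr EFin.
have : n.+1%:R != 0 :> R by [].
have : n`!%:R != 0 :> R by rewrite pnatr_eq0 -lt0n fact_gt0.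
set a := n.+1%:R; set b := n`!%:R; set c := expR _ => b0 a0.
by field; apply/andP.
Qed.

End Poisson.

Section TransitionExpectation.
Context {R : realType} {S : choiceType} {I : finType}.
Variables (r : I -> S -> R) (s : I -> S -> S) (L : R).
Hypothesis r_ge0 : forall k x, 0 <= r k x.
Hypothesis L_gt0 : 0 < L.
Hypothesis r_le : forall x, \sum_k r k x <= L.

Local Notation K := (jump_kernel r s L).

(** The state space is infinite and F may be unbounded, so the expansion of F over indicators is
    carried out with nonnegative extended sums. *)
Lemma iter_jump_kernel_esum (F : S -> R) n x : (forall z, 0 <= F z) ->
  (iter n K F x)%:E =
  (\esum_(y in [set: S]) (iter n K (fun z => (z == y)%:R) x * F y)%:E)%E.
Proof.
move=> F0; elim: n x => [|n IHn] x /=; first by rewrite esum_delta.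
have it0 y z : 0 <= iter n K (fun z => (z == y)%:R) z by apply: iter_jump_kernel_ge0.
have w0 k : 0 <= L^-1 * r k x by rewrite mulr_ge0// invr_ge0 ltW.
have a0 := jump_kernel_stay L_gt0 r_le x.
under eq_esum => y _.
  rewrite jump_kernelE (mulrDl _ _ (F y)) -mulrA mulr_suml EFinD -sumEFin EFinM.
  under [X in (_ + X)%E]eq_bigr => k _.
    rewrite -(mulrA (L^-1 * r k x)) EFinM; over.
  over.
rewrite esumD; last 2 first.
- by move=> y _; rewrite -EFinM lee_fin !mulr_ge0.
- move=> y _; rewrite sume_ge0// => k _.
  by rewrite -EFinM lee_fin (mulr_ge0 (w0 k))// mulr_ge0.
rewrite esumZl//; last by move=> y; rewrite lee_fin mulr_ge0.
rewrite esum_sum; last first.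
  by move=> y k _ _; rewrite -EFinM lee_fin (mulr_ge0 (w0 k))// mulr_ge0.
under [X in (_ + X)%E]eq_bigr => k _.
  by rewrite esumZl//; [rewrite -IHn -EFinM; over|move=> y; rewrite lee_fin mulr_ge0].
by rewrite -IHn jump_kernelE EFinD sumEFin.
Qed.

Variable P : R -> S -> S -> R.
Hypothesis P_trans : transition_function P.
Hypothesis P_gen : has_generator P (jump_generator r s).

Lemma iter_jump_kernel1 n x : iter n K (fun=> 1) x = 1.
Proof.
elim: n x => [|n IHn] x //=; rewrite /jump_kernel IHn big1 ?mulr0 ?addr0// => k _.
by rewrite IHn subrr mulr0.
Qed.

Lemma transitionE t x y : 0 <= t -> (P t x y)%:E =
  (\sum_(n <oo) (poisson (L * t) n * iter n K (fun z => (z == y)%:R) x)%:E)%E.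
Proof.
move=> t0; have Lt0 : 0 <= L * t by rewrite mulr_ge0// ltW.
pose a y n := poisson (L * t) n * iter n K (fun z => (z == y)%:R) x.
have a_ge0 z n : (0 <= (a z n)%:E)%E.
  by rewrite lee_fin mulr_ge0 ?poisson_ge0 ?iter_jump_kernel_ge0.
pose b z : \bar R := (\sum_(n <oo) (a z n)%:E)%E.
have b_le z : (b z <= (P t x z)%:E)%E.
  apply: lime_le; first exact: is_cvg_nneseries.
  near=> N; rewrite sumEFin lee_fin.
  have := exp_transition_ge r_ge0 L_gt0 r_le P_trans P_gen N z x t0.
  rewrite -(ler_pM2l (expR_gt0 (- (L * t)))) mulrA expRN mulVf ?gt_eqF ?expR_gt0// mul1r.
  apply: le_trans; rewrite /exp_poly mulr_sumr big_mkord.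
  by rewrite -expRN; apply: ler_sum => n _; rewrite /a /poisson -[leLHS]mulrA.
have b_ge0 z : (0 <= b z)%E by apply: nneseries_ge0.
have b_fin z : b z \is a fin_num.
  by rewrite ge0_fin_numE// (le_lt_trans (b_le z))// ltry.
rewrite -/(b y) -(fineK (b_fin y)); congr EFin.
apply/esym; apply: (@esum_eq_pointwise _ _ (fine \o b) (P t x) 1) => [z||].
- by rewrite /= fine_ge0//= -lee_fin fineK.
- under eq_esum do rewrite fineK// /b nneseries_esumT//.
  rewrite exchange_esum//.
  under eq_esum => n _.
    under eq_esum do rewrite EFinM.
    rewrite esumZl ?poisson_ge0//; last first.
      by move=> z; rewrite lee_fin iter_jump_kernel_ge0.
    have := iter_jump_kernel_esum n x (F := fun=> 1) (fun=> ler01).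
    under [X in _ = X -> _]eq_esum do rewrite mulr1.
    rewrite iter_jump_kernel1 => <-; rewrite mule1; over.
  by rewrite -nneseries_esumT ?poisson_sum1// => n; rewrite lee_fin poisson_ge0.
- exact: (transition_sum1 P_trans).
Unshelve. all: by end_near. Qed.

Lemma transition_expectation (F : S -> R) t x : 0 <= t -> (forall z, 0 <= F z) ->
  (\esum_(y in [set: S]) (P t x y * F y)%:E =
   \sum_(n <oo) (poisson (L * t) n * iter n K F x)%:E)%E.
Proof.
move=> t0 F0; have Lt0 : 0 <= L * t by rewrite mulr_ge0// ltW.
have it0 n y : 0 <= iter n K (fun z => (z == y)%:R) x by apply: iter_jump_kernel_ge0.
under eq_esum => y _.
  rewrite mulrC EFinM transitionE// -nneseriesZl; last first.
    by move=> n _; rewrite lee_fin mulr_ge0// poisson_ge0.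
  rewrite nneseries_esumT; last by move=> n; rewrite -EFinM lee_fin (mulr_ge0 (F0 _))// mulr_ge0// poisson_ge0.
  over.
rewrite exchange_esum; last by move=> y n; rewrite -EFinM lee_fin (mulr_ge0 (F0 _))// mulr_ge0// poisson_ge0.
rewrite -nneseries_esumT; last first.
  by move=> n; apply: esum_ge0 => y _; rewrite -EFinM lee_fin (mulr_ge0 (F0 _))// mulr_ge0// poisson_ge0.
apply: eq_eseriesr => n _.
under eq_esum do rewrite -EFinM mulrCA [F _ * _]mulrC EFinM.
rewrite esumZl ?poisson_ge0//; last by move=> y; rewrite lee_fin mulr_ge0.
by rewrite -iter_jump_kernel_esum// -EFinM.
Qed.

End TransitionExpectation.

(** * Law of the chain at a fixed time *)

Section ChainIntegral.
Context {R : realType} {S : countType}.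
Context {dT : measure_display} {T : measurableType dT}.
Variable m : {measure set T -> \bar R}.
Variables (X : R -> T -> S) (x0 : S) (Q : S -> S -> R).

(** [pickle] turns the fibres of Y into a partition indexed by the natural numbers; codes outside
    its range contribute empty sets. *)
Lemma integral_countable_rv (Y : T -> S) (F : S -> R) :
  (forall x, measurable (Y @^-1` [set x])) -> (forall x, 0 <= F x) ->
  (\int[m]_a (F (Y a))%:E =
   \esum_(x in [set: S]) ((F x)%:E * m (Y @^-1` [set x])))%E.
Proof.
move=> mY F0; pose A n := [set a | pickle (Y a) = n].
have AE n : A n = if pickle_inv n is Some x then Y @^-1` [set x] else set0.
  rewrite /A; case E : (pickle_inv n) => [x|]; apply/seteqP; split => a //=.
  - by move=> an; move: E; rewrite -an pickleK_inv => -[].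
  - move=> ->; have := @pickle_invK S n; rewrite /oapp E //.
  - by move=> an; move: E; rewrite -an pickleK_inv.
have mA n : measurable (A n) by rewrite AE; case: pickle_inv.
have UA : \bigcup_n A n = [set: T].
  by apply/seteqP; split => // a _; exists (pickle (Y a)).
have mF : measurable_fun [set: T] (fun a => (F (Y a))%:E).
  rewrite -UA; apply/measurable_fun_bigcup => // n.
  rewrite AE; case: pickle_inv => [x|]; last exact: measurable_fun_set0.
  apply: (eq_measurable_fun (cst (F x)%:E)); last exact: measurable_cst.
  by move=> a; rewrite inE /= => ->.
rewrite -[in LHS]UA ge0_integral_bigcup//; last 3 first.
- by rewrite UA.
- by move=> a _; rewrite lee_fin.
- by move=> i j _ _ [a [/= <- <-]].
rewrite nneseries_esumT; last by move=> n; apply: integral_ge0 => a _; rewrite lee_fin.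
rewrite (esumID (range (@pickle S)))/=; last first.
  by move=> n _; apply: integral_ge0 => a _; rewrite lee_fin.
rewrite [X in (_ + X)%E]esum1 ?adde0; last first.
  move=> n [_ /= nr]; rewrite AE; case E : (pickle_inv n) => [x|]; last by rewrite integral_set0.
  by exfalso; apply: nr; exists x => //; have := @pickle_invK S n; rewrite E.
rewrite setTI (@reindex_esum _ _ _ [set: S] _ (@pickle S)); last first.
  by apply: inj_bij => x y _ _ /(pcan_inj pickleK).
apply: eq_esum => x _; rewrite AE pickleK_inv.
rewrite (eq_integral (cst (F x)%:E)); last by move=> a; rewrite inE /= => ->.
by rewrite integral_cst.
Qed.

Hypothesis XQ : markov_chain m X x0 Q.

Lemma chain_expectation (I : finType) (r : I -> S -> R) (s : I -> S -> S) (L : R)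
    (F : S -> R) (t : R) :
  (forall k x, 0 <= r k x) -> 0 < L -> (forall x, \sum_k r k x <= L) ->
  Q = jump_generator r s -> 0 <= t -> (forall x, 0 <= F x) ->
  (\int[m]_a (F (X t a))%:E =
   \sum_(n <oo) (poisson (L * t) n * iter n (jump_kernel r s L) F x0)%:E)%E.
Proof.
move=> r0 L0 rL QE t0 F0.
have [P [Ptrans Pgen Plaw]] := chain_law XQ.
rewrite QE in Pgen.
rewrite -(transition_expectation r0 L0 rL Ptrans Pgen)//.
rewrite integral_countable_rv//; last by move=> x; apply: (chain_measurable XQ).
apply: eq_esum => y _.
(* The path with the single entry (t, y) gives the marginal law at time t. *)
have := Plaw [:: (t, y)]; rewrite /= t0 subr0 mulr1 => /(_ isT).
rewrite (_ : [set a | _] = X t @^-1` [set y]) => [->|].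
  by rewrite -EFinM mulrC.
apply/seteqP; split => a /=; first by move=> /(_ (t, y)); rewrite inE; apply.
by move=> Xy tx; rewrite inE => /eqP ->.
Qed.

End ChainIntegral.

(** * Bounded measurable functions *)

Section BoundedMeasurable.
Context {d : measure_display} {T : measurableType d} {R : realType}.

(** The bound holds everywhere and not just almost surely, so the class is stable under sums,
    products and measurable changes of variable, and its members are integrable for every finite
    measure. It serves both on the environment space and on the torus. *)
Definition bmfun (f : T -> R) : Prop :=
  measurable_fun [set: T] f /\ exists M, forall x, `|f x| <= M.

Lemma bmfun_ext (f g : T -> R) : (forall x, f x = g x) -> bmfun f -> bmfun g.
Proof. by move=> /funext ->. Qed.

Lemma bmfun_cst (c : R) : bmfun (fun=> c).
Proof. by split; [exact: measurable_cst|exists `|c|]. Qed.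

Lemma bmfunD (f g : T -> R) : bmfun f -> bmfun g -> bmfun (fun x => f x + g x).
Proof.
move=> [mf [M fM]] [mg [N gN]]; split; first exact: measurable_funD.
by exists (M + N) => x; rewrite (le_trans (ler_normD _ _))// lerD.
Qed.

Lemma bmfunM (f g : T -> R) : bmfun f -> bmfun g -> bmfun (fun x => f x * g x).
Proof.
move=> [mf [M fM]] [mg [N gN]]; split; first exact: measurable_funM.
by exists (M * N) => x; rewrite normrM ler_pM.
Qed.

Lemma bmfunN (f : T -> R) : bmfun f -> bmfun (fun x => - f x).
Proof.
by move=> /(bmfunM (bmfun_cst (-1))); apply: bmfun_ext => x; rewrite mulN1r.
Qed.

Lemma bmfunB (f g : T -> R) : bmfun f -> bmfun g -> bmfun (fun x => f x - g x).
Proof. by move=> bf /bmfunN; exact: bmfunD. Qed.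

Lemma bmfunX (f : T -> R) n : bmfun f -> bmfun (fun x => f x ^+ n).
Proof.
move=> bf; elim: n => [|n IHn]; first exact: bmfun_cst.
by apply: bmfun_ext (bmfunM bf IHn) => x; rewrite exprS.
Qed.

Lemma bmfun_sum (I : Type) (l : seq I) (P : pred I) (f : I -> T -> R) :
  (forall i, bmfun (f i)) -> bmfun (fun x => \sum_(i <- l | P i) f i x).
Proof.
move=> bf; elim: l => [|i l IHl].
  by apply: bmfun_ext (bmfun_cst 0) => x; rewrite big_nil.
have [Pi|Pi] := boolP (P i).
  by apply: bmfun_ext (bmfunD (bf i) IHl) => x; rewrite big_cons Pi.
by apply: bmfun_ext IHl => x; rewrite big_cons (negPf Pi).
Qed.

Lemma bmfun_comp (f : T -> R) (g : T -> T) :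
  measurable_fun [set: T] g -> bmfun f -> bmfun (fun x => f (g x)).
Proof.
move=> mg [mf [M fM]]; split; first exact: measurableT_comp mf mg.
by exists M.
Qed.

Variables (m : {finite_measure set T -> \bar R}) (D : set T).
Hypothesis mD : measurable D.

Lemma bmfun_integrable (f : T -> R) : bmfun f -> m.-integrable D (EFin \o f).
Proof.
move=> [mf [M fM]]; apply: measurable_bounded_integrable => //.
- by rewrite -ge0_fin_numE// (fin_num_measure m).
- exact: measurable_funTS.
- by exists M; split; [exact: num_real|move=> N MN x _; exact: le_trans (ltW MN)].
Qed.

Lemma Rintegral_bmfunD (f g : T -> R) : bmfun f -> bmfun g ->
  Rintegral m D (fun x => f x + g x) = Rintegral m D f + Rintegral m D g.
Proof. by move=> bf bg; rewrite RintegralD//; exact: bmfun_integrable. Qed.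

Lemma Rintegral_bmfunB (f g : T -> R) : bmfun f -> bmfun g ->
  Rintegral m D (fun x => f x - g x) = Rintegral m D f - Rintegral m D g.
Proof. by move=> bf bg; rewrite RintegralB//; exact: bmfun_integrable. Qed.

Lemma Rintegral_bmfunZ (c : R) (f : T -> R) : bmfun f ->
  Rintegral m D (fun x => c * f x) = c * Rintegral m D f.
Proof. by move=> bf; rewrite RintegralZl//; exact: bmfun_integrable. Qed.

Lemma Rintegral_bmfun_sum (I : Type) (l : seq I) (P : pred I) (f : I -> T -> R) :
  (forall i, bmfun (f i)) ->
  Rintegral m D (fun x => \sum_(i <- l | P i) f i x) =
  \sum_(i <- l | P i) Rintegral m D (f i).
Proof.
move=> bf; elim: l => [|i l IHl].
  rewrite big_nil -[RHS](mul0r (fine (m D))) -Rintegral_cst//.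
  by apply: eq_Rintegral => x _; rewrite big_nil.
rewrite big_cons -IHl; case: ifPn => Pi.
  rewrite -Rintegral_bmfunD//; last exact: bmfun_sum.
  by apply: eq_Rintegral => x _; rewrite big_cons Pi.
by apply: eq_Rintegral => x _; rewrite big_cons (negPf Pi).
Qed.

Lemma le_Rintegral_bmfun (f g : T -> R) : bmfun f -> bmfun g ->
  (forall x, D x -> f x <= g x) -> Rintegral m D f <= Rintegral m D g.
Proof. by move=> bf bg fg; apply: le_Rintegral => //; exact: bmfun_integrable. Qed.

End BoundedMeasurable.

(** * Energy of a symmetric contraction *)

Lemma discriminant_le (R : realFieldType) (a b c : R) : 0 <= c ->
  (forall x, 0 <= a + 2 * x * b + x ^+ 2 * c) -> b ^+ 2 <= a * c.
Proof.
rewrite le_eqVlt => /predU1P[<-|c0] H.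
  have [->|b0] := eqVneq b 0; first by rewrite mulr0 expr0n.
  (* With c = 0 the expression is affine in x and equals -1 at this point. *)
  have := H (- (a + 1) / (2 * b)).
  have -> : a + 2 * (- (a + 1) / (2 * b)) * b + (- (a + 1) / (2 * b)) ^+ 2 * 0 = - 1.
    by field.
  by rewrite oppr_ge0 ler10.
have := H (- b / c).
have -> : a + 2 * (- b / c) * b + (- b / c) ^+ 2 * c = (a * c - b ^+ 2) / c.
  by field; rewrite gt_eqF.
by rewrite ler_pdivlMr// mul0r subr_ge0.
Qed.

(** In (a + b)^2 the cross term is at most h a^2 + h^-1 b^2. Fixing h first, with h M small, and n
    afterwards keeps the constant M unchanged. *)
Lemma le_of_vanishing_error (R : archiRealFieldType) (x M C : R) : 0 <= M -> 0 <= C ->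
  (forall n : nat, exists a b, [/\ x = a + b, a ^+ 2 <= M & n.+1%:R * b ^+ 2 <= C]) ->
  x ^+ 2 <= M.
Proof.
move=> M0 C0 H; apply/ler_addgt0Pr => e e0.
pose h := e / (2 * (M + 1)).
have M1 : 0 < M + 1 by rewrite ltr_wpDl.
have h0 : 0 < h by rewrite divr_gt0 ?mulr_gt0.
have hM : h * M <= e / 2.
  have -> : h * M = (e / 2) * (M / (M + 1)) by rewrite /h; field; rewrite gt_eqF.
  by rewrite ler_piMr ?divr_ge0 ?(ltW e0)// ler_pdivrMr// mul1r lerDl.
pose D := (1 + h^-1) * C.
have hi0 : 0 < h^-1 by rewrite invr_gt0.
have D0 : 0 <= D by rewrite mulr_ge0// ltW// addr_gt0.
have [n nP] : exists n : nat, D <= n.+1%:R * (e / 2).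
  exists (Num.truncn (D / (e / 2))).
  by rewrite -ler_pdivrMr ?divr_gt0// ltW// truncnS_gt.
have [a [b [-> aM bC]]] := H n.
have n0 : 0 < n.+1%:R :> R by [].
have bD : (1 + h^-1) * b ^+ 2 <= e / 2.
  rewrite -(ler_pM2l n0) (le_trans _ nP)// mulrCA /D ler_wpM2l//.
  by rewrite ltW// addr_gt0.
have sq : 0 <= (h * a - b) ^+ 2 * h^-1 by rewrite mulr_ge0 ?sqr_ge0// ltW.
have sqE : (h * a - b) ^+ 2 * h^-1 = h * a ^+ 2 - 2 * a * b + h^-1 * b ^+ 2.
  by field; rewrite gt_eqF.
have ha : h * a ^+ 2 <= h * M by rewrite ler_pM2l.
rewrite sqE in sq.
have -> : (a + b) ^+ 2 = a ^+ 2 + 2 * a * b + b ^+ 2 by ring.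
move: bD; rewrite mulrDl mul1r; lra.
Qed.

Section AbstractEnergy.
Context {R : realType} {V : lmodType R}.
Variables (P : V -> Prop) (ip : V -> V -> R) (K : V -> V).
Hypothesis P0 : P 0.
Hypothesis PD : forall f g, P f -> P g -> P (f + g).
Hypothesis PZ : forall a f, P f -> P (a *: f).
Hypothesis PK : forall f, P f -> P (K f).
Hypothesis ipC : forall f g, ip f g = ip g f.
Hypothesis ipD : forall f g h, P f -> P g -> P h -> ip (f + g) h = ip f h + ip g h.
Hypothesis ipZ : forall a f h, P f -> P h -> ip (a *: f) h = a * ip f h.
Hypothesis KD : forall f g, K (f + g) = K f + K g.
Hypothesis KZ : forall a f, K (a *: f) = a *: K f.
Hypothesis ipK : forall f g, P f -> P g -> ip (K f) g = ip f (K g).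
Hypothesis ip_ge0 : forall f, P f -> 0 <= ip f f.
Hypothesis energy_ge0 : forall f, P f -> 0 <= ip f (f - K f).
Hypothesis energy_le : forall f, P f -> ip f (f - K f) <= ip f f.

Let PN f : P f -> P (- f). Proof. by rewrite -scaleN1r; exact: PZ. Qed.
Let PB f g : P f -> P g -> P (f - g). Proof. by move=> Pf /PN; exact: PD. Qed.
Let ipB f g h : P f -> P g -> P h -> ip (f - g) h = ip f h - ip g h.
Proof. by move=> Pf Pg Ph; have PNg := PN Pg; rewrite ipD// -[- g]scaleN1r ipZ// mulN1r. Qed.
Let ipDr f g h : P f -> P g -> P h -> ip h (f + g) = ip h f + ip h g.
Proof. by move=> *; rewrite ipC ipD// !(ipC h). Qed.
Let ipBr f g h : P f -> P g -> P h -> ip h (f - g) = ip h f - ip h g.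
Proof. by move=> *; rewrite ipC ipB// !(ipC h). Qed.
Let ipZr a f h : P f -> P h -> ip h (a *: f) = a * ip h f.
Proof. by move=> *; rewrite ipC ipZ// ipC. Qed.

Lemma ip_cauchy_schwarz f g : P f -> P g -> ip f g ^+ 2 <= ip f f * ip g g.
Proof.
move=> Pf Pg; apply: discriminant_le => [|x]; first exact: ip_ge0.
have Pxg := PZ x Pg.
have Ps := PD Pf Pxg; have := ip_ge0 Ps.
rewrite ipD// !ipDr// !ipZ// !ipZr// (ipC g f).
by congr (_ <= _); ring.
Qed.

Lemma energy_cauchy_schwarz f g : P f -> P g ->
  ip (f - K f) g ^+ 2 <= ip f (f - K f) * ip g (g - K g).
Proof.
move=> Pf Pg; apply: discriminant_le => [|x]; first exact: energy_ge0.
have Pxg := PZ x Pg; have PKf := PK Pf; have PKg := PK Pg.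
have := energy_ge0 (PD Pf Pxg).
rewrite KD KZ; have PxKg := PZ x PKg.
have -> : f + x *: g - (K f + x *: K g) = (f - K f) + x *: (g - K g).
  by rewrite scalerBr opprD addrACA.
have PA := PB Pf PKf; have PB' := PB Pg PKg.
have -> : ip (f + x *: g) (f - K f + x *: (g - K g)) =
    ip f (f - K f) + x * ip f (g - K g)
    + x * (ip g (f - K f) + x * ip g (g - K g)).
  move: (f - K f) (g - K g) PA PB' => A B PA PB'.
  have PxB := PZ x PB'; have Ps := PD PA PxB.
  by rewrite ipD// !ipZ// !ipDr// !ipZr//.
have -> : ip f (g - K g) = ip (f - K f) g by rewrite ipBr// ipB// ipK.
rewrite (ipC g (f - K f)).
by congr (_ <= _); ring.
Qed.

(** Let a = f - K f. Cauchy-Schwarz for the energy gives <a, a>^2 <= <f, a> <a, a - K a> <= <f, a>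
    <a, a>, so <a, a> <= <f, a>; expanding <f - a, f - a> then concludes. *)
Lemma contraction f : P f -> ip (K f) (K f) <= ip f f.
Proof.
move=> Pf; have PKf := PK Pf; pose a := f - K f; have Pa : P a by exact: PB.
have e1 := energy_cauchy_schwarz Pf Pa; rewrite -/a in e1.
have e2 := energy_le Pa; have e3 := energy_ge0 Pa.
have e4 := energy_ge0 Pf; rewrite -/a in e4.
have aa0 := ip_ge0 Pa.
have aa : ip a a <= ip f a.
  have [->//|n0] := eqVneq (ip a a) 0.
  have aap : 0 < ip a a by rewrite lt_neqAle eq_sym n0.
  rewrite -(ler_pM2r aap) -expr2 (le_trans e1)//.
  by rewrite ler_wpM2l.
have -> : K f = f - a by rewrite /a opprB addrC subrK.
clear e1 e2 e3 aa0; clearbody a.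
have Pfa := PB Pf Pa; rewrite ipB// !ipBr//.
by rewrite (ipC a f); move: aa e4; lra.
Qed.

Lemma P_iter f n : P f -> P (iter n K f).
Proof. by move=> Pf; elim: n => //= n; exact: PK. Qed.

Lemma ip_iter f g m n : P f -> P g ->
  ip (iter m K f) (iter n K g) = ip f (iter (m + n) K g).
Proof.
move=> Pf Pg; elim: m n => [//|m IHm] n /=.
have Pm := P_iter m Pf; have Pn := P_iter n Pg.
by rewrite ipK// -iterS IHm addnS.
Qed.

(** Splitting the iterates evenly between the two arguments leaves a square or, for odd n, a form
    <h, K h>, whose nonnegativity is [energy_le]. *)
Lemma autocorrelation_ge0 f n : P f -> 0 <= ip f (iter n K f).
Proof.
move=> Pf; have -> : n = ((n./2 + n./2) + odd n)%N.
  by rewrite addnn addnC odd_double_half.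
have Ph := P_iter n./2 Pf.
rewrite -addnA -ip_iter//; case: odd => /=; last by rewrite addn0 ip_ge0.
have PKh := PK Ph.
rewrite addn1 /=; have := energy_le Ph; rewrite ipBr//; lra.
Qed.

Lemma autocorrelation_even_noninc f n : P f ->
  ip f (iter (n.+1 + n.+1) K f) <= ip f (iter (n + n) K f).
Proof.
move=> Pf; rewrite -!ip_iter//=; apply: contraction; exact: P_iter.
Qed.

(** Truncated Neumann series for the inverse of 1 - K: it solves u - K u = f up to the error K^n
    f. *)
Let u f n := \sum_(j < n) iter j K f.

Let Pu f n : P f -> P (u f n).
Proof. by move=> Pf; rewrite /u; elim/big_ind: _ => // i _; exact: P_iter. Qed.

Let u_eq f n : u f n - K (u f n) = f - iter n K f.
Proof.
rewrite /u; elim: n => [|n IHn].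
  by have := KZ 0 0; rewrite !scale0r big_ord0 /= subrr sub0r => ->; rewrite oppr0.
by rewrite big_ord_recr /= KD opprD addrACA IHn addrA subrK.
Qed.

Let ip_u f h n : P f -> P h -> ip h (u f n) = \sum_(j < n) ip h (iter j K f).
Proof.
move=> Pf Ph; rewrite /u; elim: n => [|n IHn].
  by have := ipZr 0 P0 Ph; rewrite !big_ord0 scale0r mul0r.
have Pun := Pu n Pf; have Pn := P_iter n Pf.
by rewrite !big_ord_recr /= ipDr// IHn.
Qed.

(** By telescoping, the energy is <u, f> - <u, K^n f>, and the subtracted term is a sum of
    autocorrelations. *)
Let energy_u f n : P f ->
  ip (u f n) (u f n - K (u f n)) <= \sum_(j < n) ip f (iter j K f).
Proof.
move=> Pf; have Pun := Pu n Pf; have Pn := P_iter n Pf.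
rewrite u_eq ipBr// ipC ip_u// gerBl (ipC (u f n)) ip_u//.
by apply: sumr_ge0 => j _; rewrite ip_iter// autocorrelation_ge0.
Qed.

(** The even autocorrelations do not increase, so n + 1 times the last one is at most their sum; the
    odd ones, being nonnegative, can be added to reach the full partial sum. *)
Lemma autocorrelation_even_le f N n : P f ->
  (forall n, \sum_(j < n) ip f (iter j K f) <= N) ->
  n.+1%:R * ip f (iter (n + n) K f) <= N.
Proof.
move=> Pf HN.
apply: le_trans (_ : \sum_(j < n.+1) ip f (iter (j + j) K f) <= _).
  rewrite mulr_natl -[X in _ *+ X](card_ord n.+1) -sumr_const.
  apply: ler_sum => j _; have : (j <= n)%N by rewrite -ltnS.
  elim: n {HN j} (nat_of_ord j) => [|n IHn] j; first by rewrite leqn0 => /eqP ->.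
  rewrite leq_eqVlt ltnS => /predU1P[->//|/IHn].
  by apply: le_trans; exact: autocorrelation_even_noninc.
apply: le_trans (HN (n + n).+1).
elim: n => [|n IHn]; first by rewrite !big_ord1.
rewrite [leLHS]big_ord_recr /= !addSn !addnS [leRHS]big_ord_recr /= lerD//.
by rewrite [leRHS]big_ord_recr /= (le_trans IHn)// lerDl (autocorrelation_ge0 (n + n).+1).
Qed.

(** Write f as (u - K u) + K^n f. The first part is handled by Cauchy-Schwarz for the energy. The
    squared norm of the second is an even autocorrelation, hence O(1/n), and disappears in the
    limit. *)
Lemma spectral_bound f g N : P f -> P g ->
  (forall n, \sum_(j < n) ip f (iter j K f) <= N) ->
  ip f g ^+ 2 <= N * ip g (g - K g).
Proof.
move=> Pf Pg HN.
have N0 : 0 <= N by have := HN 0%N; rewrite big_ord0.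
have E0 := energy_ge0 Pg.
apply: (@le_of_vanishing_error _ _ _ (N * ip g g)).
- by rewrite mulr_ge0.
- by rewrite mulr_ge0// ip_ge0.
move=> n; have Pun := Pu n Pf; have PKun := PK Pun.
exists (ip (u f n - K (u f n)) g), (ip (iter n K f) g); split.
- by have Pn := P_iter n Pf; rewrite u_eq ipB// subrK.
- apply: le_trans (energy_cauchy_schwarz Pun Pg) _.
  by rewrite ler_wpM2r// (le_trans (energy_u n Pf)).
- have := ip_cauchy_schwarz (P_iter n Pf) Pg; rewrite ip_iter// => cs.
  apply: le_trans (_ : n.+1%:R * (ip f (iter (n + n) K f) * ip g g) <= _).
    by rewrite ler_wpM2l.
  by rewrite mulrA ler_wpM2r ?ip_ge0// autocorrelation_even_le.
Qed.

(** Converse of [spectral_bound]: testing with the Neumann sum u, whose pairing with f is S and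
    whose energy is at most S, gives S^2 <= N S. *)
Lemma autocorrelation_sum_le f N n : P f -> 0 <= N ->
  (forall g, P g -> ip f g ^+ 2 <= N * ip g (g - K g)) ->
  \sum_(j < n) ip f (iter j K f) <= N.
Proof.
move=> Pf N0 HN; have := HN _ (Pu n Pf); rewrite ip_u//.
set S := \sum_(j < n) _ => HS.
have S0 : 0 <= S by apply: sumr_ge0 => j _; exact: autocorrelation_ge0.
have [->//|Sn0] := eqVneq S 0.
have Sp : 0 < S by rewrite lt_neqAle eq_sym Sn0.
rewrite -(ler_pM2r Sp) -expr2 (le_trans HS)// ler_wpM2l//.
exact: energy_u.
Qed.

End AbstractEnergy.

(** * The stationary environment *)

Lemma opp_dirK (d : nat) : involutive (@opp_dir d).
Proof. by move=> [i b]; rewrite /opp_dir /= negbK. Qed.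

Lemma step_opp (d : nat) (k : direction d) : step (opp_dir k) = - step k.
Proof. by case: k => i []; rewrite /step /= ?opprK. Qed.

Lemma reindex_opp_dir (R : nmodType) (d : nat) (F : direction d -> R) :
  \sum_k F k = \sum_k F (opp_dir k).
Proof. by rewrite (reindex_inj (inv_inj (@opp_dirK d))). Qed.

Section EnvironmentExpectation.
Context {d : nat} {R : realType} {dO : measure_display}.
Context {Omega : measurableType dO}.
Variables (mu : probability Omega R) (tau : 'rV[int]_d -> Omega -> Omega).
Hypothesis erg : ergodic_action mu tau.

Local Notation EX f := (Rintegral mu [set: Omega] f).

Lemma EX_eq (f g : Omega -> R) : (forall w, f w = g w) -> EX f = EX g.
Proof. by move=> fg; apply: eq_Rintegral => w _. Qed.

Lemma EXD (f g : Omega -> R) : bmfun f -> bmfun g ->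
  EX (fun w => f w + g w) = EX f + EX g.
Proof. exact: Rintegral_bmfunD. Qed.

Lemma EXB (f g : Omega -> R) : bmfun f -> bmfun g ->
  EX (fun w => f w - g w) = EX f - EX g.
Proof. exact: Rintegral_bmfunB. Qed.

Lemma EXZ (c : R) (f : Omega -> R) : bmfun f -> EX (fun w => c * f w) = c * EX f.
Proof. exact: Rintegral_bmfunZ. Qed.

Lemma EX_sum (I : Type) (l : seq I) (Q : pred I) (f : I -> Omega -> R) :
  (forall i, bmfun (f i)) ->
  EX (fun w => \sum_(i <- l | Q i) f i w) = \sum_(i <- l | Q i) EX (f i).
Proof. exact: Rintegral_bmfun_sum. Qed.

Lemma EX_cst (c : R) : EX (fun=> c) = c.
Proof. rewrite Rintegral_cst// -[RHS]mulr1; congr (_ * _).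
transitivity (fine (1%E : \bar R)) => //; congr fine.
exact: (probability_setT mu). Qed.

Lemma EX_le (f g : Omega -> R) : bmfun f -> bmfun g ->
  (forall w, f w <= g w) -> EX f <= EX g.
Proof. by move=> bf bg fg; apply: le_Rintegral_bmfun. Qed.

Lemma EX_ge0 (f : Omega -> R) : (forall w, 0 <= f w) -> 0 <= EX f.
Proof. by move=> f0; exact: Rintegral_ge0. Qed.

Lemma EX_ae_eq (f g : Omega -> R) : bmfun f -> bmfun g ->
  {ae mu, forall w, f w = g w} -> EX f = EX g.
Proof.
move=> [mf _] [mg _] fg; congr fine; apply: ae_eq_integral => //.
- exact/measurable_EFinP.
- exact/measurable_EFinP.
- by apply: filterS fg => w -> _.
Qed.

Lemma EX_ae_le (f g : Omega -> R) : bmfun f -> bmfun g ->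
  {ae mu, forall w, f w <= g w} -> EX f <= EX g.
Proof.
move=> bf bg fg; rewrite -subr_ge0 -EXB//.
have bgf := bmfunB bg bf.
have bn : bmfun (fun w => `|g w - f w|).
  case: bgf => mgf [M gfM]; split; first exact: measurableT_comp mgf.
  by exists M => w; rewrite normr_id.
rewrite (EX_ae_eq bgf bn) ?EX_ge0//.
by apply: filterS fg => w fgw; rewrite ger0_norm// subr_ge0.
Qed.

Lemma bmfun_tau (f : Omega -> R) x : bmfun f -> bmfun (fun w => f (tau x w)).
Proof. by move=> bf; apply: bmfun_comp bf; exact: (action_measurable erg). Qed.

Lemma EX_tau (f : Omega -> R) x : bmfun f -> EX (fun w => f (tau x w)) = EX f.
Proof.
move=> bf; congr fine.
have mtau := action_measurable erg x.
have mf : measurable_fun [set: Omega] (EFin \o f) by apply/measurable_EFinP; case: bf.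
have intf : mu.-integrable (tau x @^-1` [set: Omega]) ((EFin \o f) \o tau x).
  by rewrite preimage_setT; exact: bmfun_integrable (bmfun_tau x bf).
have := integral_pushforward mtau mf intf measurableT.
rewrite preimage_setT => <-; apply: eq_measure_integral => A mA _.
exact: (action_preserving erg).
Qed.

Lemma EX_tauM (f g : Omega -> R) x : bmfun f -> bmfun g ->
  EX (fun w => f (tau x w) * g w) = EX (fun w => f w * g (tau (- x) w)).
Proof.
move=> bf bg; rewrite -(@EX_tau (fun w => f w * g (tau (- x) w)) x).
  by apply: EX_eq => w; rewrite -(actionD erg) addNr (action0 erg).
by apply: bmfunM => //; exact: bmfun_tau.
Qed.

(** There are 2 d directions, and an increment has squared norm at most four times that of f, so the
    energy is at most 4 d c <f, f>. This c makes the factor d / (d + 1), and d + 1 avoids a division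
    by zero when d = 0. *)
Definition lazy_rate : R := (4 * d.+1%:R)^-1.

Lemma lazy_rate_gt0 : 0 < lazy_rate.
Proof. by rewrite invr_gt0 mulr_gt0. Qed.

Definition lazy_kernel (f : Omega -> R) (w : Omega) : R :=
  f w - lazy_rate * \sum_(k : direction d) (f w - f (tau (step k) w)).

Lemma bmfun_lazy (f : Omega -> R) : bmfun f -> bmfun (lazy_kernel f).
Proof.
move=> bf; apply: bmfunB => //; apply: bmfunM; first exact: bmfun_cst.
by apply: bmfun_sum => k; apply: bmfunB => //; exact: bmfun_tau.
Qed.

Lemma EX_lazyM (f g : Omega -> R) : bmfun f -> bmfun g ->
  EX (fun w => lazy_kernel f w * g w) = EX (fun w => f w * g w)
   - lazy_rate * \sum_(k : direction d)
       (EX (fun w => f w * g w) - EX (fun w => f (tau (step k) w) * g w)).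
Proof.
move=> bf bg; have bft k := bmfun_tau (step k) bf.
rewrite (EX_eq (g := fun w => f w * g w - lazy_rate * \sum_(k : direction d)
   (f w * g w - f (tau (step k) w) * g w))); last first.
  move=> w; rewrite /lazy_kernel mulrBl -mulrA mulr_suml; congr (_ - _ * _).
  by apply: eq_bigr => k _; rewrite mulrBl.
have bfg := bmfunM bf bg; have bftg k := bmfunM (bft k) bg.
have bs : bmfun (fun w => \sum_(k : direction d) (f w * g w - f (tau (step k) w) * g w)).
  by apply: bmfun_sum => k; exact: bmfunB.
rewrite EXB//; last by apply: bmfunM bs; exact: bmfun_cst.
rewrite EXZ// EX_sum; last by move=> k; exact: bmfunB.
by congr (_ - _ * _); apply: eq_bigr => k _; rewrite EXB.
Qed.

(** The shift by a step has the shift by the opposite step as adjoint, and the sum runs over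
    both. *)
Lemma EX_lazy_sym (f g : Omega -> R) : bmfun f -> bmfun g ->
  EX (fun w => lazy_kernel f w * g w) = EX (fun w => f w * lazy_kernel g w).
Proof.
move=> bf bg; rewrite EX_lazyM//.
rewrite [RHS](EX_eq (g := fun w => lazy_kernel g w * f w)); last by move=> w; rewrite mulrC.
rewrite EX_lazyM//; congr (_ - _ * _); first by apply: EX_eq => w; rewrite mulrC.
rewrite [RHS]reindex_opp_dir; apply: eq_bigr => k _; congr (_ - _).
  by apply: EX_eq => w; rewrite mulrC.
rewrite EX_tauM// -step_opp; by apply: EX_eq => w; rewrite mulrC.
Qed.

Lemma EX_increment_sq (f : Omega -> R) x : bmfun f ->
  EX (fun w => (f (tau x w) - f w) ^+ 2) =
  2 * (EX (fun w => f w * f w) - EX (fun w => f (tau x w) * f w)).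
Proof.
move=> bf; have bft := bmfun_tau x bf.
rewrite (EX_eq (g := fun w => (f (tau x w) * f (tau x w) + f w * f w)
  - 2 * (f (tau x w) * f w))); last by move=> w; ring.
rewrite EXB; last 2 first.
- by apply: bmfunD; exact: bmfunM.
- by apply: bmfunM; [exact: bmfun_cst|exact: bmfunM].
rewrite EXD ?EXZ; try exact: bmfunM.
rewrite (@EX_tau (fun w => f w * f w)); last exact: bmfunM.
ring.
Qed.

Lemma EX_lazy_energy (f : Omega -> R) : bmfun f ->
  EX (fun w => f w * (f w - lazy_kernel f w)) =
  lazy_rate / 2 * \sum_(k : direction d) EX (fun w => (f (tau (step k) w) - f w) ^+ 2).
Proof.
move=> bf; have bK := bmfun_lazy bf.
rewrite (EX_eq (g := fun w => f w * f w - lazy_kernel f w * f w)); last by move=> w; ring.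
rewrite EXB ?EX_lazyM//; try exact: bmfunM.
under [in RHS]eq_bigr do rewrite EX_increment_sq//.
by rewrite -mulr_sumr; set s := \sum_(_ : direction d) _; field.
Qed.

Lemma EX_lazy_energy_ge0 (f : Omega -> R) : bmfun f ->
  0 <= EX (fun w => f w * (f w - lazy_kernel f w)).
Proof.
move=> bf; rewrite EX_lazy_energy// mulr_ge0//.
  by rewrite divr_ge0// ltW// lazy_rate_gt0.
by apply: sumr_ge0 => k _; apply: EX_ge0 => w; exact: sqr_ge0.
Qed.

Lemma EX_lazy_energy_le (f : Omega -> R) : bmfun f ->
  EX (fun w => f w * (f w - lazy_kernel f w)) <= EX (fun w => f w * f w).
Proof.
move=> bf; rewrite EX_lazy_energy//.
have bff := bmfunM bf bf.
have ff0 : 0 <= EX (fun w => f w * f w).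
  by apply: EX_ge0 => w; rewrite -expr2 sqr_ge0.
apply: le_trans (_ : lazy_rate / 2 * \sum_(k : direction d) 4 * EX (fun w => f w * f w) <= _).
  rewrite ler_wpM2l ?divr_ge0 ?(ltW lazy_rate_gt0)//.
  apply: ler_sum => k _; have bft := bmfun_tau (step k) bf.
  apply: le_trans (_ : EX (fun w => 2 * (f (tau (step k) w) * f (tau (step k) w)) + 2 * (f w * f w)) <= _).
    apply: EX_le => [||w]; last by have := sqr_ge0 (f (tau (step k) w) + f w); nra.
      by apply: bmfunX; exact: bmfunB.
    by apply: bmfunD; (apply: bmfunM; [exact: bmfun_cst|exact: bmfunM]).
  rewrite EXD ?EXZ; try exact: bmfunM; try by apply: bmfunM; [exact: bmfun_cst|exact: bmfunM].
  rewrite (@EX_tau (fun w => f w * f w))//.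
  lra.
rewrite sumr_const card_prod card_ord card_bool -[_ *+ (d * 2)]mulr_natl natrM.
set e := EX _; rewrite /lazy_rate; have d0 : 0 < d.+1%:R :> R by [].
have -> : (4 * d.+1%:R)^-1 / 2 * (d%:R * 2 * (4 * e)) = d%:R / d.+1%:R * e.
  move: d0; set a := d.+1%:R; set b := d%:R => a0.
  by field; rewrite gt_eqF.
by rewrite ler_piMl// ler_pdivrMr// mul1r ler_nat.
Qed.

(** [R^o] makes the functions a left module over R; [bm] singles out the subspace on which the
    integral of a product is bilinear. *)
Let V := (Omega -> R^o).
Let bm (f : V) := bmfun (f : Omega -> R).
Let ip (f g : V) := EX (fun w => (f w : R) * g w).
Let K : V -> V := lazy_kernel.

Let P0 : bm 0. Proof. exact: bmfun_cst. Qed.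
Let PD (f g : V) : bm f -> bm g -> bm (f + g). Proof. exact: bmfunD. Qed.
Let PZ (a : R) (f : V) : bm f -> bm (a *: f).
Proof. by apply: bmfunM; exact: bmfun_cst. Qed.
Let ipC (f g : V) : ip f g = ip g f.
Proof. by apply: EX_eq => w; rewrite mulrC. Qed.
Let ipD (f g h : V) : bm f -> bm g -> bm h -> ip (f + g) h = ip f h + ip g h.
Proof.
move=> bf bg bh; rewrite /ip -EXD; try exact: bmfunM.
by apply: EX_eq => w; rewrite -mulrDl.
Qed.
Let ipZ (a : R) (f h : V) : bm f -> bm h -> ip (a *: f) h = a * ip f h.
Proof.
move=> bf bh; rewrite /ip -EXZ; last exact: bmfunM.
by apply: EX_eq => w; rewrite mulrA.
Qed.
Let KD (f g : V) : K (f + g) = K f + K g.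
Proof.
apply/funext => w; rewrite /K /lazy_kernel !fctE.
rewrite addrACA -opprD -mulrDr -big_split /=; congr (_ - _ * _).
by apply: eq_bigr => k _; rewrite opprD addrACA.
Qed.
Let KZ (a : R) (f : V) : K (a *: f) = a *: K f.
Proof.
apply/funext => w; rewrite /K /lazy_kernel !fctE /GRing.scale /=.
rewrite [RHS]mulrBr; congr (_ - _); rewrite [RHS]mulrCA; congr (_ * _); rewrite mulr_sumr.
by apply: eq_bigr => k _; rewrite mulrBr.
Qed.
Let ip_ge0 (f : V) : bm f -> 0 <= ip f f.
Proof. by move=> _; apply: EX_ge0 => w; rewrite -expr2 sqr_ge0. Qed.

Section SpectralBounds.
Variable f : Omega -> R.
Hypothesis bf : bmfun f.

Lemma EX_autocorrelation_ge0 n : 0 <= EX (fun w => f w * iter n lazy_kernel f w).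
Proof.
exact: (autocorrelation_ge0 PZ bmfun_lazy ipC ipD ipZ EX_lazy_sym ip_ge0
  EX_lazy_energy_le).
Qed.

Lemma EX_spectral_bound (g : Omega -> R) N : bmfun g ->
  (forall n, \sum_(j < n) EX (fun w => f w * iter j lazy_kernel f w) <= N) ->
  EX (fun w => f w * g w) ^+ 2 <= N * EX (fun w => g w * (g w - lazy_kernel g w)).
Proof.
move=> bg HN; exact: (spectral_bound P0 PD PZ bmfun_lazy ipC ipD ipZ KD KZ
  EX_lazy_sym ip_ge0 EX_lazy_energy_ge0 EX_lazy_energy_le bf bg HN).
Qed.

Lemma EX_autocorrelation_sum_le N n : 0 <= N ->
  (forall g, bmfun g -> EX (fun w => f w * g w) ^+ 2 <=
     N * EX (fun w => g w * (g w - lazy_kernel g w))) ->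
  \sum_(j < n) EX (fun w => f w * iter j lazy_kernel f w) <= N.
Proof.
move=> N0 HN; exact: (autocorrelation_sum_le P0 PD PZ bmfun_lazy ipC ipD ipZ KD KZ
  EX_lazy_sym ip_ge0 EX_lazy_energy_le n bf N0 HN).
Qed.

End SpectralBounds.

End EnvironmentExpectation.

(** * Second moment of the walk *)

Lemma weighted_sqr_le (R : realFieldType) (I : finType) (q x : I -> R) :
  (forall k, 0 <= q k) ->
  (\sum_k q k * x k) ^+ 2 <= (\sum_k q k) * (\sum_k q k * x k ^+ 2).
Proof.
move=> q0; rewrite mulrC; apply: discriminant_le => [|y]; first by apply: sumr_ge0.
have -> : \sum_k q k * x k ^+ 2 + 2 * y * (\sum_k q k * x k) + y ^+ 2 * \sum_k q k
    = \sum_k q k * (x k + y) ^+ 2.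
  rewrite !mulr_sumr -!big_split /=; apply: eq_bigr => k _; ring.
by apply: sumr_ge0 => k _; rewrite mulr_ge0// sqr_ge0.
Qed.

Lemma dotZD (d : nat) (R : realType) (v : 'rV[R]_d) x y :
  dotZ v (x + y) = dotZ v x + dotZ v y.
Proof.
rewrite /dotZ -big_split /=; apply: eq_bigr => i _.
by rewrite mxE intrD mulrDr.
Qed.

Lemma dotZ_opp_dir (d : nat) (R : realType) (v : 'rV[R]_d) (k : direction d) :
  dotZ v (step (opp_dir k)) = - dotZ v (step k).
Proof.
rewrite step_opp /dotZ -sumrN; apply: eq_bigr => i _.
by rewrite mxE mulrNz mulrN.
Qed.

Lemma sum_dotZ_sqr (d : nat) (R : realType) (v : 'rV[R]_d) :
  \sum_(k : direction d) dotZ v (step k) ^+ 2 = 2 * \sum_(i < d) v 0 i ^+ 2.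
Proof.
have e1 i : dotZ v (step (i, true)) = v 0 i.
  rewrite /dotZ (bigD1 i)//= /step /= mxE !eqxx mulr1 big1 ?addr0// => j ji.
  by rewrite mxE (negPf ji) andbF mulr0.
have e2 i : dotZ v (step (i, false)) = - v 0 i.
  by rewrite -(e1 i) -dotZ_opp_dir.
rewrite (eq_bigr (fun k : direction d => dotZ v (step (k.1, k.2)) ^+ 2)); last by case.
rewrite -(pair_bigA _ (fun i b => dotZ v (step (i, b)) ^+ 2)) /= mulr_sumr.
by apply: eq_bigr => i _; rewrite big_bool /= e1 e2 sqrrN mulr2n mulrDl mul1r.
Qed.

Section WalkMoments.
Context {d : nat} {R : realType} {dO : measure_display}.
Context {Omega : measurableType dO}.
Variables (mu : probability Omega R) (tau : 'rV[int]_d -> Omega -> Omega).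
Hypothesis erg : ergodic_action mu tau.
Variables (p : direction d -> Omega -> R) (s_up s_low : R).
Hypothesis p_meas : forall k, measurable_fun [set: Omega] (p k).
Hypothesis p_bounded : forall k w, 0 <= p k w <= s_up.
Hypothesis bistoch : {ae mu, forall w,
  \sum_(k : direction d) p k w = \sum_(k : direction d) p (opp_dir k) (tau (step k) w)}.
Variable v : 'rV[R]_d.

Local Notation EX f := (Rintegral mu [set: Omega] f).
Local Notation e k := (dotZ v (step k)).

Let p_ge0 k w : 0 <= p k w. Proof. by case/andP: (p_bounded k w). Qed.
Let p_le k w : p k w <= s_up. Proof. by case/andP: (p_bounded k w). Qed.

Lemma bmfun_rate k : bmfun (p k).
Proof. by split=> //; exists s_up => w; rewrite ger0_norm. Qed.
Let bp := bmfun_rate.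
Let bt f x := @bmfun_tau d R dO Omega mu tau erg f x.

Lemma rate_sum_le w : \sum_(k : direction d) p k w <= s_up * (2 * d%:R).
Proof.
apply: le_trans (_ : \sum_(k : direction d) s_up <= _); first exact: ler_sum.
by rewrite sumr_const card_prod card_ord card_bool -[_ *+ (d * 2)]mulr_natr
  natrM [2 * _]mulrC.
Qed.

Definition env_generator (f : Omega -> R) (w : Omega) : R :=
  \sum_(k : direction d) p k w * (f (tau (step k) w) - f w).

Definition drift (w : Omega) : R := \sum_(k : direction d) e k * p k w.

Definition variance_rate (w : Omega) : R :=
  \sum_(k : direction d) e k ^+ 2 * p k w.

Definition mixed_rate (h : Omega -> R) (w : Omega) : R :=
  \sum_(k : direction d) e k * p k w * h (tau (step k) w).

Definition next_mean (L : R) (h : Omega -> R) (w : Omega) : R :=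
  h w + L^-1 * (drift w + env_generator h w).

Definition next_moment (L : R) (h c : Omega -> R) (w : Omega) : R :=
  c w + L^-1 * (variance_rate w + 2 * mixed_rate h w + env_generator c w).

(** The pair (h_n, c_n): quenched mean and second moment of v.X after n steps of the uniformized
    chain started at the origin. *)
Fixpoint moments (L : R) (n : nat) : (Omega -> R) * (Omega -> R) :=
  if n is n'.+1 then let hc := moments L n' in (next_mean L hc.1, next_moment L hc.1 hc.2)
  else (fun=> 0, fun=> 0).

Local Notation mean L n := (moments L n).1.
Local Notation moment L n := (moments L n).2.

Lemma iter_jump_kernel_moments (L : R) n w x :
  iter n (jump_kernel (fun k y => p k (tau y w)) (fun k y => y + step k) L)
    (fun y => dotZ v y ^+ 2) x =
  dotZ v x ^+ 2 + 2 * dotZ v x * mean L n (tau x w) + moment L n (tau x w).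
Proof.
elim: n x => [|n IHn] x /=; first by rewrite mulr0 !addr0.
rewrite /jump_kernel IHn /next_mean /next_moment.
set h := mean L n; set c := moment L n; set y := tau x w.
move: (erefl (dotZ v x)); set a := {2 3 4 5 6 7 8}(dotZ v x); clearbody a => aE.
have -> : \sum_(k : direction d) p k y *
    (iter n (jump_kernel (fun k y => p k (tau y w)) (fun k y => y + step k) L)
      (fun y => dotZ v y ^+ 2) (x + step k) - (a ^+ 2 + 2 * a * h y + c y)) =
   2 * a * (drift y + env_generator h y) +
   (variance_rate y + 2 * mixed_rate h y + env_generator c y).
  rewrite /drift /env_generator /variance_rate /mixed_rate.
  rewrite -big_split /= 2!mulr_sumr -!big_split /=; apply: eq_bigr => k _.
  rewrite IHn dotZD aE [x + _]addrC (actionD erg) -/y -/h -/c; ring.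
ring.
Qed.

Lemma bmfun_env_generator f : bmfun f -> bmfun (env_generator f).
Proof.
move=> bf; apply: bmfun_sum => k; apply: bmfunM => //; apply: bmfunB => //.
exact: bt.
Qed.

Lemma bmfun_drift : bmfun drift.
Proof. by apply: bmfun_sum => k; apply: bmfunM => //; exact: bmfun_cst. Qed.

Lemma bmfun_variance_rate : bmfun variance_rate.
Proof. by apply: bmfun_sum => k; apply: bmfunM => //; exact: bmfun_cst. Qed.

Lemma bmfun_mixed_rate h : bmfun h -> bmfun (mixed_rate h).
Proof.
move=> bh; apply: bmfun_sum => k; apply: bmfunM; last exact: bt.
by apply: bmfunM => //; exact: bmfun_cst.
Qed.

Lemma bmfun_moments L n : bmfun (mean L n) /\ bmfun (moment L n).
Proof.
elim: n => [|n [bh bc]] /=; first by split; exact: bmfun_cst.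
have bL := bmfun_cst (T := Omega) L^-1.
split; apply: bmfunD => //; apply: bmfunM => //; apply: bmfunD.
- exact: bmfun_drift.
- exact: bmfun_env_generator.
- apply: bmfunD; first exact: bmfun_variance_rate.
  by apply: bmfunM; [exact: bmfun_cst|exact: bmfun_mixed_rate].
- exact: bmfun_env_generator.
Qed.

(** By [iter_jump_kernel_moments] at x = 0, this is the iterated kernel applied to a square and
    evaluated at the origin. *)
Lemma moment_ge0 L n w : 0 < L -> s_up * (2 * d%:R) <= L -> 0 <= moment L n w.
Proof.
move=> L0 Lbig.
have := @iter_jump_kernel_ge0 R _ _ (fun k y => p k (tau y w))
  (fun (k : direction d) y => y + step k) L _ L0 _ (fun y => dotZ v y ^+ 2) n 0.
rewrite iter_jump_kernel_moments (action0 erg).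
have -> : dotZ v 0 = 0.
  by rewrite /dotZ big1// => i _; rewrite mxE mulr0.
rewrite expr0n mulr0 mul0r !add0r; apply => // [x|z]; last exact: sqr_ge0.
exact: le_trans (rate_sum_le _) Lbig.
Qed.

Lemma EX_rate_shift f k : bmfun f ->
  EX (fun w => p k w * f (tau (step k) w)) =
  EX (fun w => f w * p k (tau (step (opp_dir k)) w)).
Proof.
by move=> bf; rewrite step_opp -(EX_tauM erg)//; apply: EX_eq => w; rewrite mulrC.
Qed.

(** Moving the shifts from f onto the rates leaves the integral of f times inflow minus outflow,
    which bistochasticity makes vanish almost everywhere. *)
Lemma EX_env_generator f : bmfun f -> EX (env_generator f) = 0.
Proof.
move=> bf; have bft k := bt (step k) bf; have bpt k := bt (step k) (bp (opp_dir k)).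
rewrite EX_sum; last by move=> k; apply: bmfunM => //; exact: bmfunB.
have -> : \sum_(k : direction d) EX (fun w => p k w * (f (tau (step k) w) - f w)) =
   \sum_(k : direction d) EX (fun w => f w * p k (tau (step (opp_dir k)) w)) -
   \sum_(k : direction d) EX (fun w => f w * p k w).
  rewrite -sumrB; apply: eq_bigr => k _.
  rewrite -EX_rate_shift// -EXB; try exact: bmfunM.
  by apply: EX_eq => w; ring.
rewrite reindex_opp_dir; under eq_bigr do rewrite opp_dirK.
rewrite -!EX_sum; try by move=> k; exact: bmfunM.
rewrite -EXB; try by apply: bmfun_sum => k; exact: bmfunM.
rewrite -[RHS](EX_cst mu 0); apply: EX_ae_eq; first by apply: bmfunB; apply: bmfun_sum => k; exact: bmfunM.
  exact: bmfun_cst.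
by apply: filterS bistoch => w bw; rewrite -!mulr_sumr -bw subrr.
Qed.

(* This is v . phi; the drift of the time-reversed walk is [2 current - drift]. *)
Definition current (w : Omega) : R := \sum_(k : direction d) e k * flow tau p k w.

Lemma bmfun_current : bmfun current.
Proof.
apply: bmfun_sum => k; apply: bmfunM; first exact: bmfun_cst.
by apply: bmfunM; [exact: bmfun_cst|apply: bmfunB => //; exact: bt].
Qed.

(** After the shift and the change of k into its opposite, the weight on direction k is minus the
    reversed rate, that is, twice the flow minus the rate. *)
Lemma EX_mixed_rate h : bmfun h ->
  EX (mixed_rate h) = EX (fun w => h w * (2 * current w - drift w)).
Proof.
move=> bh; have bht k := bt (step k) bh; have bpt k := bt (step k) (bp (opp_dir k)).
rewrite EX_sum; last first.
  by move=> k; apply: bmfunM => //; apply: bmfunM => //; exact: bmfun_cst.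
under eq_bigr => k _.
  rewrite (EX_eq mu (g := fun w => e k * (p k w * h (tau (step k) w)))); last first.
    by move=> w; ring.
  rewrite EXZ; last exact: bmfunM.
  rewrite EX_rate_shift//; over.
rewrite reindex_opp_dir; under eq_bigr => k _.
  rewrite opp_dirK -EXZ; last exact: bmfunM.
  over.
rewrite -EX_sum; last first.
  by move=> k; apply: bmfunM; [exact: bmfun_cst|exact: bmfunM].
apply: EX_eq => w; rewrite /current /drift mulr_sumr -sumrB mulr_sumr.
by apply: eq_bigr => k _; rewrite dotZ_opp_dir /flow; field.
Qed.

(** Carré du champ: the generator applied to h^2 is twice h times the generator of h plus the
    weighted squared increments, and its integral is 0 by stationarity. *)
Lemma EX_dirichlet h : bmfun h ->
  EX (fun w => h w * env_generator h w) =
  - (2^-1 * \sum_(k : direction d) EX (fun w => p k w * (h (tau (step k) w) - h w) ^+ 2)).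
Proof.
move=> bh; have bht k := bt (step k) bh.
have bd k : bmfun (fun w => p k w * (h (tau (step k) w) - h w) ^+ 2).
  by apply: bmfunM => //; apply: bmfunX; exact: bmfunB.
have := EX_env_generator (bmfunM bh bh).
rewrite (EX_eq mu (g := fun w => 2 * (h w * env_generator h w) +
   \sum_(k : direction d) p k w * (h (tau (step k) w) - h w) ^+ 2)); last first.
  move=> w; rewrite /env_generator !mulr_sumr -big_split /=.
  by apply: eq_bigr => k _; ring.
have bhg : bmfun (fun w => h w * env_generator h w).
  by apply: bmfunM => //; exact: bmfun_env_generator.
rewrite EXD; [|by apply: bmfunM => //; exact: bmfun_cst|exact: bmfun_sum].
rewrite EXZ// EX_sum// => H; lra.
Qed.

(* Reversing the bond (w, tau_k w) exchanges p_k with its reversal and leaves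
   the squared increment unchanged. *)
Lemma EX_bond_symmetry (a : direction d -> R) h : bmfun h ->
  (forall k, a (opp_dir k) = - a k) ->
  \sum_(k : direction d) EX (fun w => p k w * (a k + h (tau (step k) w) - h w) ^+ 2) =
  \sum_(k : direction d)
     EX (fun w => conductance tau p k w * (a k + h (tau (step k) w) - h w) ^+ 2).
Proof.
move=> bh ha; have bht k := bt (step k) bh; have bpt k := bt (step k) (bp (opp_dir k)).
pose Q k w := (a k + h (tau (step k) w) - h w) ^+ 2.
have bQ k : bmfun (Q k).
  by apply: bmfunX; apply: bmfunB => //; apply: bmfunD => //; exact: bmfun_cst.
have Qopp k w : Q (opp_dir k) (tau (step k) w) = Q k w.
  rewrite /Q ha -(actionD erg) step_opp addNr (action0 erg); ring.
have E k : EX (fun w => conductance tau p k w * Q k w) =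
    2^-1 * EX (fun w => p k w * Q k w) +
    2^-1 * EX (fun w => p (opp_dir k) w * Q (opp_dir k) w).
  rewrite -(EX_tau erg (f := fun w => p (opp_dir k) w * Q (opp_dir k) w) (step k)); last exact: bmfunM.
  have bpQ : bmfun (fun w => p (opp_dir k) (tau (step k) w) * Q (opp_dir k) (tau (step k) w)).
    by apply: (bt (step k) (f := fun w => p (opp_dir k) w * Q (opp_dir k) w)); exact: bmfunM.
  have bpQ' := bmfunM (bp k) (bQ k).
  rewrite -!EXZ// -EXD; try by apply: bmfunM => //; exact: bmfun_cst.
  by apply: EX_eq => w; rewrite Qopp /conductance; ring.
rewrite [RHS](eq_bigr _ (fun k _ => E k)) big_split /= -!mulr_sumr.
rewrite -(reindex_opp_dir (fun k => EX (fun w => p k w * Q k w))).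
by set s := \sum_(k : direction d) _; field.
Qed.

Definition dirichlet (h : Omega -> R) : R :=
  2^-1 * \sum_(k : direction d) EX (fun w => p k w * (h (tau (step k) w) - h w) ^+ 2).

Lemma dirichlet_ge0 h : 0 <= dirichlet h.
Proof.
rewrite mulr_ge0// sumr_ge0// => k _; apply: EX_ge0 => w.
by rewrite mulr_ge0// sqr_ge0.
Qed.

Hypothesis elliptic : {ae mu, forall w, forall k, s_low <= conductance tau p k w}.

(** Ellipticity bounds the conductances and not the rates themselves, so the bonds are symmetrized
    before the lower bound is applied. The antisymmetric term [a] covers both a pure gradient and
    v.x plus a gradient. *)
Lemma EX_bond_elliptic (a : direction d -> R) h : bmfun h ->
  (forall k, a (opp_dir k) = - a k) ->
  s_low * (\sum_(k : direction d) EX (fun w => (a k + h (tau (step k) w) - h w) ^+ 2)) <=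
  \sum_(k : direction d) EX (fun w => p k w * (a k + h (tau (step k) w) - h w) ^+ 2).
Proof.
move=> bh ha; have bht k := bt (step k) bh; have bpt k := bt (step k) (bp (opp_dir k)).
rewrite EX_bond_symmetry// mulr_sumr; apply: ler_sum => k _.
have bQ : bmfun (fun w => (a k + h (tau (step k) w) - h w) ^+ 2).
  by apply: bmfunX; apply: bmfunB => //; apply: bmfunD => //; exact: bmfun_cst.
rewrite -EXZ//; apply: EX_ae_le.
- by apply: bmfunM => //; exact: bmfun_cst.
- by apply: bmfunM => //; apply: bmfunM; [exact: bmfun_cst|exact: bmfunD].
- by apply: filterS elliptic => w Hw; rewrite ler_wpM2r ?sqr_ge0.
Qed.

(** Passes from the energy of the lazy kernel, which the spectral measure sees, to the Dirichlet
    form of the walk. *)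
Lemma dirichlet_lazy_le h : bmfun h ->
  s_low * EX (fun w => h w * (h w - lazy_kernel tau h w)) <= @lazy_rate d R * dirichlet h.
Proof.
move=> bh; rewrite (EX_lazy_energy erg)// /dirichlet.
have := @EX_bond_elliptic (fun=> 0) h bh (fun=> esym (oppr0 _)).
have -> : \sum_(k : direction d) EX (fun w => p k w * (0 + h (tau (step k) w) - h w) ^+ 2) =
   \sum_(k : direction d) EX (fun w => p k w * (h (tau (step k) w) - h w) ^+ 2).
  by apply: eq_bigr => k _; apply: EX_eq => w; rewrite add0r.
have -> : \sum_(k : direction d) EX (fun w => (0 + h (tau (step k) w) - h w) ^+ 2) =
   \sum_(k : direction d) EX (fun w => (h (tau (step k) w) - h w) ^+ 2).
  by apply: eq_bigr => k _; apply: EX_eq => w; rewrite add0r.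
have := @lazy_rate_gt0 d R; nra.
Qed.

Lemma EX_variance_le : EX variance_rate <= 2 * s_up * \sum_(i < d) v 0 i ^+ 2.
Proof.
rewrite -(EX_cst mu (2 * s_up * _)); apply: EX_le; first exact: bmfun_variance_rate.
  exact: bmfun_cst.
move=> w; rewrite mulrAC -sum_dotZ_sqr mulr_suml; apply: ler_sum => k _.
by rewrite ler_wpM2l ?sqr_ge0.
Qed.

(** Jump energy at the origin of the function x -> v.x + h (tau_x w). *)
Definition increment_sq (h : Omega -> R) (w : Omega) : R :=
  \sum_(k : direction d) p k w * (e k + h (tau (step k) w) - h w) ^+ 2.

Lemma bmfun_increment_sq h : bmfun h -> bmfun (increment_sq h).
Proof.
move=> bh; apply: bmfun_sum => k; apply: bmfunM => //; apply: bmfunX.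
by apply: bmfunB => //; apply: bmfunD; [exact: bmfun_cst|exact: bt].
Qed.

(** A gradient of h has mean zero under a shift-invariant measure, so the increment along k has mean
    v.k and second moment at least (v.k)^2. The sum of the (v.k)^2 over all directions is 2
    |v|^2. *)
Lemma EX_increment_ge h : bmfun h -> 0 <= s_low ->
  2 * s_low * (\sum_(i < d) v 0 i ^+ 2) <= EX (increment_sq h).
Proof.
move=> bh s0; have bht k := bt (step k) bh.
have bY k : bmfun (fun w => e k + h (tau (step k) w) - h w).
  by apply: bmfunB => //; apply: bmfunD => //; exact: bmfun_cst.
rewrite EX_sum; last by move=> k; apply: bmfunM => //; exact: bmfunX.
apply: le_trans (EX_bond_elliptic bh (dotZ_opp_dir v)).
rewrite [2 * s_low]mulrC -mulrA -sum_dotZ_sqr ler_wpM2l//; apply: ler_sum => k _.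
have mean_e : EX (fun w => e k + h (tau (step k) w) - h w) = e k.
  rewrite EXB// ?EXD// ?EX_cst ?(EX_tau erg)//; try exact: bmfun_cst.
    by rewrite addrK.
  by apply: bmfunD => //; exact: bmfun_cst.
have := EX_ge0 mu (f := fun w => (e k + h (tau (step k) w) - h w - e k) ^+ 2) (fun w => sqr_ge0 _).
rewrite (EX_eq mu (g := fun w => (e k + h (tau (step k) w) - h w) ^+ 2 -
  (2 * e k * (e k + h (tau (step k) w) - h w) - e k ^+ 2))); last by move=> w; ring.
have bZ : bmfun (fun w => 2 * e k * (e k + h (tau (step k) w) - h w)).
  by apply: bmfunM => //; exact: bmfun_cst.
have bc := bmfun_cst (T := Omega) (e k ^+ 2).
have bY2 := bmfunX 2 (bY k); have bZc := bmfunB bZ bc.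
rewrite EXB// EXB// EXZ// mean_e EX_cst; nra.
Qed.

Lemma EX_increment_sqE h : bmfun h ->
  EX (increment_sq h) = EX variance_rate
    + 2 * EX (fun w => h w * (2 * current w - drift w))
    - 2 * EX (fun w => h w * drift w) + 2 * dirichlet h.
Proof.
move=> bh; have bht k := bt (step k) bh.
have bv := bmfun_variance_rate; have bm := bmfun_mixed_rate bh.
have bhd := bmfunM bh bmfun_drift; have b2 := bmfun_cst (T := Omega) (2 : R).
have bk k : bmfun (fun w => p k w * (h (tau (step k) w) - h w) ^+ 2).
  by apply: bmfunM => //; apply: bmfunX; exact: bmfunB.
have bs := bmfun_sum (index_enum (direction d)) xpredT bk.
rewrite (EX_eq mu (g := fun w => (variance_rate w + 2 * mixed_rate h w - 2 * (h w * drift w))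
  + \sum_(k : direction d) p k w * (h (tau (step k) w) - h w) ^+ 2)); last first.
  move=> w; rewrite /increment_sq /variance_rate /mixed_rate /drift.
  rewrite !mulr_sumr -sumrN -!big_split /=; apply: eq_bigr => k _; ring.
have b2m := bmfunM b2 bm; have b2d := bmfunM b2 bhd.
have bvm := bmfunD bv b2m; have bvmd := bmfunB bvm b2d.
rewrite EXD// EXB// EXD// !EXZ// EX_mixed_rate//.
rewrite [X in _ + X = _]EX_sum; last exact: bk.
by rewrite /dirichlet; set s := \sum_(k : direction d) _; field.
Qed.

Lemma drift_env_sq_le h w :
  (drift w + env_generator h w) ^+ 2 <= s_up * (2 * d%:R) * increment_sq h w.
Proof.
have -> : drift w + env_generator h w =
    \sum_(k : direction d) p k w * (e k + h (tau (step k) w) - h w).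
  rewrite /drift /env_generator -big_split /=; apply: eq_bigr => k _; ring.
apply: le_trans (weighted_sqr_le _ (fun k => p_ge0 k w)) _.
apply: ler_wpM2r (rate_sum_le w); apply: sumr_ge0 => k _.
by rewrite mulr_ge0// sqr_ge0.
Qed.

Lemma EX_moment_step L n : EX (moment L n.+1) = EX (moment L n) +
  L^-1 * (EX variance_rate + 2 * EX (fun w => mean L n w * (2 * current w - drift w))).
Proof.
have [bh bc] := bmfun_moments L n; have bL := bmfun_cst (T := Omega) L^-1.
have bm := bmfun_mixed_rate bh; have b2 := bmfun_cst (T := Omega) (2 : R).
have bg := bmfun_env_generator bc; have bv := bmfun_variance_rate.
have b2m := bmfunM b2 bm; have bvm := bmfunD bv b2m; have bvmg := bmfunD bvm bg.
have bLv := bmfunM bL bvmg.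
rewrite -EX_mixed_rate// /next_moment EXD// EXZ// EXD// EX_env_generator// addr0.
by rewrite EXD// EXZ.
Qed.

Lemma EX_mean_sq_step L n : EX (fun w => mean L n.+1 w ^+ 2) =
  EX (fun w => mean L n w ^+ 2) +
  L^-1 * (2 * EX (fun w => mean L n w * drift w) - 2 * dirichlet (mean L n)) +
  L^-1 ^+ 2 * EX (fun w => (drift w + env_generator (mean L n) w) ^+ 2).
Proof.
have [bh _] := bmfun_moments L n; have bL := bmfun_cst (T := Omega) L^-1.
set h := mean L n in bh *; have b2 := bmfun_cst (T := Omega) (2 : R).
have bg := bmfun_env_generator bh; have bd := bmfun_drift.
have bdg := bmfunD bd bg; have bhd := bmfunM bh bd; have bhg := bmfunM bh bg.
have bh2 := bmfunX 2 bh; have bdg2 := bmfunX 2 bdg.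
have bhdg := bmfunD bhd bhg; have b2h := bmfunM b2 bhdg; have bL2 := bmfunM bL b2h.
have bLL := bmfun_cst (T := Omega) (L^-1 ^+ 2); have bLL2 := bmfunM bLL bdg2.
have b3 := bmfunD bh2 bL2.
rewrite (EX_eq mu (g := fun w => h w ^+ 2 + L^-1 * (2 * (h w * drift w + h w * env_generator h w))
  + L^-1 ^+ 2 * (drift w + env_generator h w) ^+ 2)); last first.
  by move=> w; rewrite /= /next_mean -/h; ring.
by rewrite EXD// EXD// !EXZ// EXD// EX_dirichlet// -/(dirichlet h); ring.
Qed.

Lemma EX_mean_sq0 L : EX (fun w => mean L 0 w ^+ 2) = 0.
Proof. by rewrite -[RHS](EX_cst mu 0); apply: EX_eq => w; rewrite /= expr0n. Qed.

(** The induction runs on the averaged quenched variance E (c_n - h_n^2). Its increment is the jump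
    energy over L minus a second-order term, which Cauchy-Schwarz bounds by A / L^2 times the same
    energy. *)
Lemma EX_moment_lower L n : 0 < L -> s_up * (2 * d%:R) <= L -> 0 <= s_low ->
  n%:R * (L^-1 * (1 - L^-1 * (s_up * (2 * d%:R))) *
    (2 * s_low * \sum_(i < d) v 0 i ^+ 2)) <= EX (moment L n).
Proof.
move=> L0 Lbig s0; set A := s_up * _; set B := 2 * s_low * _.
suff H : n%:R * (L^-1 * (1 - L^-1 * A) * B) <= EX (moment L n) - EX (fun w => mean L n w ^+ 2).
  have := EX_ge0 mu (f := fun w => mean L n w ^+ 2) (fun w => sqr_ge0 _); lra.
elim: n => [|n IHn].
  by rewrite EX_mean_sq0 mul0r subr0 [EX _](EX_cst mu 0).
rewrite -natr1 mulrDl mul1r EX_moment_step EX_mean_sq_step.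
have [bh _] := bmfun_moments L n; set h := mean L n in bh IHn *.
have bdg := bmfunD bmfun_drift (bmfun_env_generator bh).
have Wge : B <= EX (increment_sq h) := EX_increment_ge bh s0.
have Wle : EX (fun w => (drift w + env_generator h w) ^+ 2) <= A * EX (increment_sq h).
  have bW := bmfun_increment_sq bh.
  rewrite -EXZ//; apply: EX_le; [exact: bmfunX| |exact: drift_env_sq_le].
  by apply: bmfunM => //; exact: bmfun_cst.
move: (EX_increment_sqE bh) Wge Wle.
set W := EX (increment_sq h); set Y := EX (fun w => (_ + _) ^+ 2).
set x1 := EX variance_rate; set x2 := EX _; set x3 := EX _; set x4 := dirichlet h.
move=> WE Wge Wle.
have Li0 : 0 < L^-1 by rewrite invr_gt0.
have LA : 0 <= 1 - L^-1 * A by rewrite subr_ge0 mulrC ler_pdivrMr// mul1r.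
have s1 : L^-1 * (1 - L^-1 * A) * B <= L^-1 * (1 - L^-1 * A) * W.
  by rewrite ler_wpM2l// mulr_ge0// ltW.
have s2 : L^-1 ^+ 2 * Y <= L^-1 ^+ 2 * (A * W) by rewrite ler_wpM2l// exprn_ge0// ltW.
have s3 : L^-1 * (1 - L^-1 * A) * W = L^-1 * W - L^-1 ^+ 2 * (A * W) by ring.
have s4 : L^-1 * W = L^-1 * (x1 + 2 * x2) - L^-1 * (2 * x3 - 2 * x4) by rewrite WE; ring.
move: IHn s1 s2 s3 s4; lra.
Qed.

(** With V the averaged variance rate and D the Dirichlet form of h_n, the increment of E (c_n +
    h_n^2) is L^-1 (V + 4 <v.phi, h_n> - 2 D) plus a second-order term. For L >= 4 A that term is at
    most L^-1 (V / 2 + D), which leaves one D to absorb the pairing. Since V <= 2 [s_up] |v|^2, the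
    constant 3 is 3/2 times 2. *)
Lemma EX_moment_upper L n N : 0 < L -> 4 * (s_up * (2 * d%:R)) <= L -> 0 <= N ->
  (forall h, bmfun h -> EX (fun w => current w * h w) ^+ 2 <= N * dirichlet h) ->
  EX (moment L n) <=
  n%:R * (L^-1 * (3 * s_up * (\sum_(i < d) v 0 i ^+ 2) + 4 * N)).
Proof.
move=> L0 + N0 HN; set A := s_up * (2 * d%:R) => Lbig; set S := \sum_(i < d) _.
suff H : EX (moment L n) + EX (fun w => mean L n w ^+ 2) <= n%:R * (L^-1 * (3 * s_up * S + 4 * N)).
  have := EX_ge0 mu (f := fun w => mean L n w ^+ 2) (fun w => sqr_ge0 _); lra.
elim: n => [|n IHn].
  by rewrite EX_mean_sq0 mul0r addr0 [EX _](EX_cst mu 0).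
rewrite -natr1 mulrDl mul1r EX_moment_step EX_mean_sq_step.
have [bh _] := bmfun_moments L n; set h := mean L n in bh IHn *.
have bd := bmfun_drift; have bg := bmfun_env_generator bh; have bdg := bmfunD bd bg.
have bht k := bt (step k) bh.
have b2 := bmfun_cst (T := Omega) (2 : R).
have bv := bmfun_variance_rate.
have A0 : 0 <= A.
  rewrite -(EX_cst mu A); apply: le_trans (_ : EX (fun w => \sum_(k : direction d) p k w) <= _).
    by apply: EX_ge0 => w; exact: sumr_ge0.
  by apply: EX_le; [exact: bmfun_sum|exact: bmfun_cst|exact: rate_sum_le].
have bk k : bmfun (fun w => p k w * (h (tau (step k) w) - h w) ^+ 2).
  by apply: bmfunM => //; apply: bmfunX; exact: bmfunB.
have bs := bmfun_sum (index_enum (direction d)) xpredT bk.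
have Yle : EX (fun w => (drift w + env_generator h w) ^+ 2) <=
    2 * A * EX variance_rate + 4 * A * dirichlet h.
  have -> : 2 * A * EX variance_rate + 4 * A * dirichlet h =
    EX (fun w => 2 * A * (variance_rate w +
       \sum_(k : direction d) p k w * (h (tau (step k) w) - h w) ^+ 2)).
    rewrite EXZ ?EXD//; last exact: bmfunD.
    rewrite [X in _ = _ * (_ + X)]EX_sum; last exact: bk.
    by rewrite /dirichlet; set s := \sum_(k : direction d) _; field.
  apply: EX_le; [exact: bmfunX| |move=> w].
    by apply: bmfunM; [exact: bmfun_cst|exact: bmfunD].
  have w1 := weighted_sqr_le (fun k => e k) (fun k => p_ge0 k w).
  have w2 := weighted_sqr_le (fun k => h (tau (step k) w) - h w) (fun k => p_ge0 k w).
  have w3 := rate_sum_le w; rewrite -/A in w3.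
  have d1 : drift w = \sum_(k : direction d) p k w * e k.
    by apply: eq_bigr => k _; rewrite mulrC.
  have d2 : variance_rate w = \sum_(k : direction d) p k w * e k ^+ 2.
    by apply: eq_bigr => k _; rewrite mulrC.
  rewrite -d1 -d2 in w1; rewrite -/(env_generator h w) in w2.
  set V := variance_rate w in d2 w1 *; set Q := \sum_(k : direction d) p k w * (_ - _) ^+ 2 in w2 *.
  have V0 : 0 <= V by rewrite d2; apply: sumr_ge0 => k _; rewrite mulr_ge0// sqr_ge0.
  have Q0 : 0 <= Q by apply: sumr_ge0 => k _; rewrite mulr_ge0// sqr_ge0.
  have w4 := ler_wpM2r V0 w3; have w5 := ler_wpM2r Q0 w3.
  have := sqr_ge0 (drift w - env_generator h w).
  move: w1 w2 w4 w5; set x := drift w; set y := env_generator h w; nra.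
have HNh := HN h bh.
have bc := bmfun_current; have bhc := bmfunM bh bc; have bhd := bmfunM bh bd.
have E2 : EX (fun w => h w * (2 * current w - drift w)) =
    2 * EX (fun w => current w * h w) - EX (fun w => h w * drift w).
  rewrite (EX_eq mu (f := fun w => current w * h w) (g := fun w => h w * current w)); last first.
    by move=> w; rewrite mulrC.
  have b2c := bmfunM b2 bhc.
  rewrite -EXZ// -EXB//; apply: EX_eq => w; ring.
rewrite E2; have := EX_variance_le; have D0 := dirichlet_ge0 h.
move: Yle HNh; rewrite -/S.
set Y := EX (fun w => (_ + _) ^+ 2); set x1 := EX variance_rate.
set x2 := EX (fun w => current w * h w); set x3 := EX (fun w => h w * drift w).
set x4 := dirichlet h in D0 *.
move=> Yle HNh x1le.
have Li0 : 0 < L^-1 by rewrite invr_gt0.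
have LA : 4 * (L^-1 * A) <= 1 by rewrite mulrCA mulrC ler_pdivrMr// mul1r.
have x10 : 0 <= x1.
  apply: EX_ge0 => w; apply: sumr_ge0 => k _; by rewrite mulr_ge0// sqr_ge0.
(* Arithmetic-geometric mean: (4 x2)^2 <= 16 N x4 <= (4 N + x4)^2. *)
have x2le : 4 * x2 <= 4 * N + x4.
  rewrite real_leNgt ?num_real//; apply/negP => H.
  have : (4 * N + x4) ^+ 2 < (4 * x2) ^+ 2.
    by rewrite ltr_pXn2r// nnegrE; nra.
  have := sqr_ge0 (4 * N - x4); nra.
clearbody x1 x2 x3 x4 Y.
have s1 : L^-1 ^+ 2 * Y <= L^-1 * (2^-1 * x1 + x4).
  rewrite expr2 -mulrA ler_pM2l//.
  have : L^-1 * Y <= L^-1 * (2 * A * x1 + 4 * A * x4) by rewrite ler_pM2l.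
  have : (4 * (L^-1 * A)) * (2^-1 * x1 + x4) <= 1 * (2^-1 * x1 + x4).
    by rewrite ler_wpM2r// addr_ge0// mulr_ge0.
  lra.
have s2 : L^-1 * (x1 + 2 * (2 * x2 - x3)) + L^-1 * (2 * x3 - 2 * x4) + L^-1 * (2^-1 * x1 + x4)
   <= L^-1 * (3 * s_up * S + 4 * N).
  rewrite -!mulrDr ler_pM2l//; lra.
move: IHn s1 s2; lra.
Qed.

End WalkMoments.

(** * Integration against charges *)

Section ChargeIntegral.
Context {d : measure_display} {T : measurableType d} {R : realType}.
Implicit Type nu : {charge set T -> \bar R}.

(** [charge_integral] rests on a chosen Hahn decomposition. The choice is opened here once;
    afterwards only the two finite measures and their values on sets are used. *)
Lemma charge_integral_jordan nu :
  exists (mp mn : {finite_measure set T -> \bar R}) (P N : set T),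
  [/\ hahn_decomposition nu P N,
      forall A, measurable A -> mp A = nu (A `&` P),
      forall A, measurable A -> mn A = (- nu (A `&` N))%E &
      forall D f, charge_integral nu D f =
        (\int[mp]_(x in D) f x - \int[mn]_(x in D) f x)%E].
Proof.
rewrite /charge_integral.
set hP := cid (Hahn_decomposition nu); set hN := cid (projT2 hP).
exists (jordan_pos (projT2 hN)), (jordan_neg (projT2 hN)), (projT1 hP), (projT1 hN).
split => //; first exact: (projT2 hN).
- move=> A mA; have := jordan_posE (projT2 hN) A.
  by rewrite cjordan_posE /crestr0 mem_set.
- move=> A mA; have := jordan_negE (projT2 hN) A.
  by rewrite cjordan_negE /crestr0 mem_set.
Qed.

Lemma charge_integral_nonneg nu : (forall A, measurable A -> (0 <= nu A)%E) ->
  exists m : {finite_measure set T -> \bar R},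
  (forall A, measurable A -> m A = nu A) /\
  forall D f, charge_integral nu D f = (\int[m]_(x in D) f x)%E.
Proof.
move=> nu0; have [mp [mn [P [N [hahn mpE mnE intE]]]]] := charge_integral_jordan nu.
have [[mP _] [mN negN] PN1 PN0] := hahn.
have nuN A : measurable A -> nu (A `&` N) = 0%E.
  move=> mA; apply/eqP; rewrite eq_le nu0 ?andbT; last exact: measurableI.
  by apply: negN; [exact: measurableI|exact: subIsetr].
exists mp; split => [A mA|D f].
  rewrite mpE// -[in RHS](setIT A) -PN1 setIUr chargeU.
  - by rewrite nuN// adde0.
  - exact: measurableI.
  - exact: measurableI.
  - by rewrite setIACA PN0 setI0.
rewrite intE [X in (_ - X)%E](_ : _ = 0%E) ?sube0//.
rewrite (eq_measure_integral mzero) ?integral_measure_zero// => A mA _.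
by have := mnE A mA; rewrite nuN// oppe0.
Qed.

Lemma integral_series_bmfun (m : {finite_measure set T -> \bar R}) (D : set T)
    (f : nat -> T -> R) : measurable D -> (forall n, bmfun (f n)) ->
  (forall n x, 0 <= f n x) ->
  (\int[m]_(x in D) (\sum_(n <oo) (f n x)%:E) =
   \sum_(n <oo) (Rintegral m D (f n))%:E)%E.
Proof.
move=> mD bf f0; have mf n : measurable_fun D (EFin \o f n).
  by apply: measurable_funTS; apply/measurable_EFinP; case: (bf n).
rewrite (integral_nneseries _ _ mf)//; last by move=> n x _; rewrite lee_fin.
apply: eq_eseriesr => n _; rewrite /Rintegral fineK//.
exact: integrable_fin_num (bmfun_integrable m mD (bf n)).
Qed.

Section ChargeRintegral.
Variables (nu : {charge set T -> \bar R}) (D : set T).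
Hypothesis mD : measurable D.

Lemma charge_RintegralE (mp mn : {finite_measure set T -> \bar R}) (f : T -> R) :
  (forall f, charge_integral nu D f =
        (\int[mp]_(x in D) f x - \int[mn]_(x in D) f x)%E) -> bmfun f ->
  charge_Rintegral nu D f = Rintegral mp D f - Rintegral mn D f.
Proof.
move=> E bf; rewrite /charge_Rintegral E fineB//;
  exact: integrable_fin_num (bmfun_integrable _ mD bf).
Qed.

Lemma charge_RintegralD (f g : T -> R) : bmfun f -> bmfun g ->
  charge_Rintegral nu D (fun x => f x + g x) =
  charge_Rintegral nu D f + charge_Rintegral nu D g.
Proof.
move=> bf bg; have [mp [mn [P [N [_ _ _ /(_ D) E]]]]] := charge_integral_jordan nu.
have bfg := bmfunD bf bg.
by rewrite !(charge_RintegralE E)// !Rintegral_bmfunD// opprD addrACA.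
Qed.

Lemma charge_RintegralZ (a : R) (f : T -> R) : bmfun f ->
  charge_Rintegral nu D (fun x => a * f x) = a * charge_Rintegral nu D f.
Proof.
move=> bf; have [mp [mn [P [N [_ _ _ /(_ D) E]]]]] := charge_integral_jordan nu.
have baf := bmfunM (bmfun_cst a) bf.
by rewrite !(charge_RintegralE E)// !Rintegral_bmfunZ// mulrBr.
Qed.

Lemma eq_charge_Rintegral (f g : T -> R) : (forall x, f x = g x) ->
  charge_Rintegral nu D f = charge_Rintegral nu D g.
Proof. by move=> /funext ->. Qed.

Lemma charge_Rintegral0 : charge_Rintegral nu D (fun=> 0) = 0.
Proof.
rewrite -[RHS](mul0r (charge_Rintegral nu D (fun=> 0))) -charge_RintegralZ.
  by apply: eq_charge_Rintegral => x; rewrite mul0r.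
exact: bmfun_cst.
Qed.

Lemma charge_RintegralB (f g : T -> R) : bmfun f -> bmfun g ->
  charge_Rintegral nu D (fun x => f x - g x) =
  charge_Rintegral nu D f - charge_Rintegral nu D g.
Proof.
move=> bf bg; rewrite -mulN1r -charge_RintegralZ// -charge_RintegralD//.
  by apply: eq_charge_Rintegral => x; rewrite mulN1r.
by apply: bmfunM => //; exact: bmfun_cst.
Qed.

Lemma charge_Rintegral_sum (I : Type) (l : seq I) (Q : pred I) (f : I -> T -> R) :
  (forall i, bmfun (f i)) ->
  charge_Rintegral nu D (fun x => \sum_(i <- l | Q i) f i x) =
  \sum_(i <- l | Q i) charge_Rintegral nu D (f i).
Proof.
move=> bf; elim: l => [|i l IHl].
  by rewrite [RHS]big_nil -[RHS]charge_Rintegral0; apply: eq_charge_Rintegral => x; rewrite big_nil.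
rewrite big_cons -IHl; case: ifPn => Qi; last first.
  by apply: eq_charge_Rintegral => x; rewrite big_cons (negPf Qi).
rewrite -charge_RintegralD//; last exact: bmfun_sum.
by apply: eq_charge_Rintegral => x; rewrite big_cons Qi.
Qed.

Variables (f : nat -> T -> R).
Hypothesis bf : forall n, bmfun (f n).
Hypothesis f_ge0 : forall n x, 0 <= f n x.
Local Notation G := (fun x => \sum_(n <oo) (f n x)%:E)%E.

Lemma charge_integral_series_lty (B : R) :
  (forall A, measurable A -> (0 <= nu A)%E) ->
  (forall n, \sum_(j < n) charge_Rintegral nu D (f j) <= B) ->
  (charge_integral nu D G < +oo)%E.
Proof.
move=> nu0 HB; have [m [_ mE]] := charge_integral_nonneg nu0.
have CE j : charge_Rintegral nu D (f j) = Rintegral m D (f j).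
  by rewrite /charge_Rintegral mE.
rewrite mE integral_series_bmfun//; apply: (@le_lt_trans _ _ B%:E); last exact: ltry.
apply: lime_le.
  by apply: is_cvg_nneseries => n _ _; rewrite lee_fin; apply: Rintegral_ge0.
near=> n; rewrite sumEFin lee_fin big_mkord.
by under eq_bigr do rewrite -CE.
Unshelve. all: by end_near. Qed.

Lemma nneseries_fin_cvg (a : nat -> R) (S : \bar R) : (forall n, 0 <= a n) ->
  (\sum_(n <oo) (a n)%:E = S)%E -> S \is a fin_num ->
  (\sum_(j < n) a j) @[n --> \oo] --> fine S.
Proof.
move=> a0 E Sfin.
have H : (\sum_(j < n) a j)%:E @[n --> \oo] --> (fine S)%:E.
  rewrite fineK// -E.
  have -> : (fun n => (\sum_(j < n) a j)%:E) = (fun n => \sum_(0 <= j < n) (a j)%:E)%E.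
    by apply/funext => n; rewrite sumEFin big_mkord.
  by apply: is_cvg_nneseries => n _ _; rewrite lee_fin.
exact: (fine_cvg H).
Qed.

(** Both Jordan parts of nu are dominated by l1 + l2, so each integral of the series is finite even
    though the series may take the value +oo. The difference is then meaningful and can be computed
    term by term. *)
Lemma charge_integral_series_cvg (l1 l2 : {charge set T -> \bar R}) :
  (forall A, measurable A -> (0 <= l1 A)%E) ->
  (forall A, measurable A -> (0 <= l2 A)%E) ->
  (forall A, measurable A -> (nu A <= l1 A + l2 A)%E) ->
  (forall A, measurable A -> (- nu A <= l1 A + l2 A)%E) ->
  (charge_integral l1 D G < +oo)%E -> (charge_integral l2 D G < +oo)%E ->
  charge_integral nu D G \is a fin_num /\
  (\sum_(j < n) charge_Rintegral nu D (f j)) @[n --> \oo] -->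
    fine (charge_integral nu D G).
Proof.
move=> l10 l20 le1 le2.
have [m1 [m1E ->]] := charge_integral_nonneg l10.
have [m2 [m2E ->]] := charge_integral_nonneg l20 => fin1 fin2.
have [mp [mn [P [N [hahn mpE mnE /(_ D) intE]]]]] := charge_integral_jordan nu.
have [[mP _] [mN _] _ _] := hahn.
have G0 x : (0 <= G x)%E by apply: nneseries_ge0 => n _ _; rewrite lee_fin.
have mG : measurable_fun [set: T] G.
  apply: ge0_emeasurable_sum => [n x _ _|n _]; first by rewrite lee_fin.
  by apply/measurable_EFinP; case: (bf n).
have dom (m : {finite_measure set T -> \bar R}) :
   (forall A, measurable A -> (m A <= m1 A + m2 A)%E) ->
   (\int[m]_(x in D) G x)%E \is a fin_num.
  move=> mle; rewrite ge0_fin_numE; last exact: integral_ge0.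
  apply: le_lt_trans (ge0_le_measure_integral (m2 := measure_add m1 m2) _ mD G0 mG) _.
    by move=> A mA; have := mle A mA; rewrite -(measure_addE m1 m2).
  rewrite ge0_integral_measure_add//; last exact: measurable_funTS.
  exact: lte_add_pinfty.
have finp : (\int[mp]_(x in D) G x)%E \is a fin_num.
  apply: dom => A mA; rewrite mpE//; have mAP := measurableI _ _ mA mP.
  rewrite (le_trans (le1 _ mAP))// -m1E// -m2E// leeD//;
    by apply: le_measure; rewrite ?inE//; exact: subIsetl.
have finn : (\int[mn]_(x in D) G x)%E \is a fin_num.
  apply: dom => A mA; rewrite mnE//; have mAN := measurableI _ _ mA mN.
  rewrite (le_trans (le2 _ mAN))// -m1E// -m2E// leeD//;
    by apply: le_measure; rewrite ?inE//; exact: subIsetl.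
rewrite intE; split; first by rewrite fin_numB finp.
rewrite fineB//.
have -> : (fun n => \sum_(j < n) charge_Rintegral nu D (f j)) =
    (fun n => \sum_(j < n) Rintegral mp D (f j) - \sum_(j < n) Rintegral mn D (f j)).
  apply/funext => n; rewrite -sumrB; apply: eq_bigr => j _.
  exact: (charge_RintegralE intE).
have cv (m : {finite_measure set T -> \bar R}) : (\int[m]_(x in D) G x)%E \is a fin_num ->
    (\sum_(j < n) Rintegral m D (f j)) @[n --> \oo] --> fine (\int[m]_(x in D) G x)%E.
  move=> mfin; apply: (@nneseries_fin_cvg (fun j => Rintegral m D (f j))) mfin.
    by move=> j; apply: Rintegral_ge0.
  by rewrite integral_series_bmfun.
exact: (cvgB (cv mp finp) (cv mn finn)).
Qed.

End ChargeRintegral.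
End ChargeIntegral.

(** * Fourier symbols and spectral measures *)

Section Torus.
Context {d : nat} {R : realType}.

Definition angle (x : 'rV[int]_d) (q : d.-tuple R) : R :=
  \sum_(i < d) (x 0 i)%:~R * tnth q i.

Lemma angleD x y q : angle (x + y) q = angle x q + angle y q.
Proof.
by rewrite /angle -big_split /=; apply: eq_bigr => i _; rewrite mxE intrD mulrDl.
Qed.

Lemma angleN x q : angle (- x) q = - angle x q.
Proof.
by rewrite /angle -sumrN; apply: eq_bigr => i _; rewrite mxE mulrNz mulNr.
Qed.

Lemma angle0 q : angle 0 q = 0.
Proof. by rewrite /angle big1// => i _; rewrite mxE mul0r. Qed.

Lemma angle_step i q : angle (step (i, true)) q = tnth q i.
Proof.
rewrite /angle (bigD1 i)//= /step /= mxE !eqxx mul1r big1 ?addr0// => j ji.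
by rewrite mxE (negPf ji) andbF mul0r.
Qed.

Lemma measurable_angle x : measurable_fun [set: d.-tuple R] (angle x).
Proof.
apply: measurable_sum => i; apply: measurable_funM => //.
exact: measurable_tnth.
Qed.

Lemma bmfun_cos x : bmfun (fun q => cos (angle x q) : R).
Proof.
split; last by exists 1 => q; rewrite ler_norml cos_geN1 cos_le1.
apply: measurableT_comp (measurable_angle x).
by apply: continuous_measurable_fun; exact: continuous_cos.
Qed.

Lemma bmfun_sin x : bmfun (fun q => sin (angle x q) : R).
Proof.
split; last by exists 1 => q; rewrite ler_norml sin_geN1 sin_le1.
apply: measurableT_comp (measurable_angle x).
by apply: continuous_measurable_fun; exact: continuous_sin.
Qed.

Lemma measurable_torus : measurable (@torus d R).
Proof.
have -> : @torus d R = \bigcap_(i in [set: 'I_d])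
    ((fun q : d.-tuple R => tnth q i) @^-1` `[(- pi), pi[%classic).
  by apply/seteqP; split => q H i; have := H i; rewrite /= ?in_itv/= => //; apply.
apply: fin_bigcap_measurable => // i _; rewrite -[X in measurable X]setTI.
by apply: measurable_tnth => //; exact: measurable_itv.
Qed.

Definition lazy_symbol (q : d.-tuple R) : R :=
  1 - @lazy_rate d R * \sum_(k : direction d) (1 - cos (angle (step k) q)).

Lemma lazy_symbolE q : lazy_symbol q =
  1 - 2 * @lazy_rate d R * \sum_(m < d) (1 - cos (tnth q m)).
Proof.
rewrite /lazy_symbol [2 * _]mulrC -mulrA; congr (_ - _ * _).
rewrite (eq_bigr (fun k : direction d => 1 - cos (angle (step (k.1, k.2)) q))); last by case.
rewrite -(pair_bigA _ (fun i b => 1 - cos (angle (step (i, b)) q))) /= mulr_sumr.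
apply: eq_bigr => i _; rewrite big_bool /= angle_step.
have -> : step (i, false) = - step (i, true) by rewrite -step_opp.
by rewrite angleN cosN angle_step; ring.
Qed.

Lemma bmfun_lazy_symbol : bmfun lazy_symbol.
Proof.
apply: bmfunB; first exact: bmfun_cst.
apply: bmfunM; first exact: bmfun_cst.
by apply: bmfun_sum => k; apply: bmfunB; [exact: bmfun_cst|exact: bmfun_cos].
Qed.

Lemma lazy_symbol_bounds q : 0 <= lazy_symbol q <= 1.
Proof.
have c0 := @lazy_rate_gt0 d R; rewrite lazy_symbolE.
have s0 : 0 <= \sum_(m < d) (1 - cos (tnth q m)).
  by apply: sumr_ge0 => m _; rewrite subr_ge0 cos_le1.
have s2 : \sum_(m < d) (1 - cos (tnth q m)) <= d.+1%:R * 2.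
  apply: le_trans (_ : \sum_(m < d) 2 <= _).
    by apply: ler_sum => m _; have := cos_geN1 (tnth q m); lra.
  by rewrite sumr_const card_ord -[_ *+ d]mulr_natl ler_wpM2r// ler_nat.
have c4 : @lazy_rate d R * (d.+1%:R * 2) = 2^-1.
  rewrite /lazy_rate; have : d.+1%:R != 0 :> R by [].
  by move: (d.+1%:R) => a a0; field.
have := ler_wpM2l (ltW c0) s2; have := mulr_ge0 (ltW c0) s0; lra.
Qed.

(** The real form of the statement that characters are eigenfunctions of the lazy kernel: the sine
    terms from opposite directions cancel. *)
Lemma lazy_symbol_cos x q :
  cos (angle x q) - @lazy_rate d R *
    \sum_(k : direction d) (cos (angle x q) - cos (angle (x + step k) q)) =
  lazy_symbol q * cos (angle x q).
Proof.
rewrite /lazy_symbol mulrBl mul1r -mulrA mulr_suml; congr (_ - _ * _).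
have S0 : \sum_(k : direction d) sin (angle (step k) q) = 0.
  have : \sum_(k : direction d) sin (angle (step k) q) =
         - \sum_(k : direction d) sin (angle (step k) q).
    rewrite {1}reindex_opp_dir -sumrN; apply: eq_bigr => k _.
    by rewrite step_opp angleN sinN.
  lra.
have -> : \sum_(k : direction d) (cos (angle x q) - cos (angle (x + step k) q)) =
   \sum_(k : direction d) (1 - cos (angle (step k) q)) * cos (angle x q) +
   (\sum_(k : direction d) sin (angle (step k) q)) * sin (angle x q).
  rewrite mulr_suml -big_split /=; apply: eq_bigr => k _.
  by rewrite angleD cosD; ring.
by rewrite S0 mul0r addr0.
Qed.

Lemma lazy_symbol_sin x q :
  sin (angle x q) - @lazy_rate d R *
    \sum_(k : direction d) (sin (angle x q) - sin (angle (x + step k) q)) =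
  lazy_symbol q * sin (angle x q).
Proof.
rewrite /lazy_symbol mulrBl mul1r -mulrA mulr_suml; congr (_ - _ * _).
have S0 : \sum_(k : direction d) sin (angle (step k) q) = 0.
  have : \sum_(k : direction d) sin (angle (step k) q) =
         - \sum_(k : direction d) sin (angle (step k) q).
    rewrite {1}reindex_opp_dir -sumrN; apply: eq_bigr => k _.
    by rewrite step_opp angleN sinN.
  lra.
have -> : \sum_(k : direction d) (sin (angle x q) - sin (angle (x + step k) q)) =
   \sum_(k : direction d) (1 - cos (angle (step k) q)) * sin (angle x q) -
   (\sum_(k : direction d) sin (angle (step k) q)) * cos (angle x q).
  rewrite mulr_suml -sumrB /=; apply: eq_bigr => k _.
  by rewrite angleD sinD; ring.
by rewrite S0 mul0r subr0.
Qed.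

(* Geometric series: 1 - symbol = 2 c sum (1 - cos q_m) for the lazy rate c. *)
Lemma inv_laplacian_series q :
  inv_laplacian q = (\sum_(n <oo) (2 * @lazy_rate d R * lazy_symbol q ^+ n)%:E)%E.
Proof.
have c0 := @lazy_rate_gt0 d R; have /andP[k0 k1] := lazy_symbol_bounds q.
rewrite /inv_laplacian; set s := \sum_(m < d) _.
have kE : lazy_symbol q = 1 - 2 * @lazy_rate d R * s by rewrite lazy_symbolE.
have s0 : 0 <= s by apply: sumr_ge0 => m _; rewrite subr_ge0 cos_le1.
have term0 n : (0 <= (2 * @lazy_rate d R * lazy_symbol q ^+ n)%:E)%E.
  by rewrite lee_fin !mulr_ge0 ?(ltW c0)// exprn_ge0.
rewrite inver; have [sz|sn0] := eqVneq s 0.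
  have k1E : lazy_symbol q = 1 by rewrite kE sz mulr0 subr0.
  apply/esym/eqyP => A A0; pose a := 2 * @lazy_rate d R.
  have a0 : 0 < a by rewrite mulr_gt0.
  have [n nP] : exists n : nat, A <= n%:R * a.
    exists (Num.truncn (A / a)).+1.
    by rewrite -ler_pdivrMr// ltW// truncnS_gt.
  apply: le_trans (nneseries_lim_ge n _) => //.
  rewrite sumEFin lee_fin (le_trans nP)// big_mkord.
  rewrite (eq_bigr (fun=> a)); last by move=> i _; rewrite k1E expr1n mulr1.
  by rewrite sumr_const card_ord mulr_natl.
have sp : 0 < s by rewrite lt_neqAle eq_sym sn0.
have klt : `|lazy_symbol q| < 1.
  by rewrite ger0_norm// kE ltrBlDr ltrDl !mulr_gt0.
have cv := @cvg_geometric_series R (2 * @lazy_rate d R) _ klt.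
have -> : s^-1 = 2 * @lazy_rate d R / (1 - lazy_symbol q).
  by rewrite kE subKr; field; rewrite !gt_eqF.
rewrite -(cvg_lim _ cv)//.
rewrite -EFin_lim; last by apply/cvg_ex; exists (2 * @lazy_rate d R / (1 - lazy_symbol q)).
by apply: congr_lim; apply/funext => n; rewrite /= sumEFin.
Qed.

End Torus.

Lemma big_two (R : nmodType) (I : finType) (i j : I) (F : I -> R) : i != j ->
  (forall k, k != i -> k != j -> F k = 0) -> \sum_k F k = F i + F j.
Proof.
move=> ij F0; rewrite (bigD1 i)//= (bigD1 j)/=; last by rewrite eq_sym.
by rewrite big1 ?addr0// => k /andP[ki kj]; exact: F0.
Qed.

(** * Spectral measures and autocorrelations of the lazy kernel *)

Section SpectralRepresentation.
Context {d : nat} {R : realType} {dO : measure_display}.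
Context {Omega : measurableType dO}.
Variables (mu : probability Omega R) (tau : 'rV[int]_d -> Omega -> Omega).
Hypothesis erg : ergodic_action mu tau.
Variable F : 'I_d -> Omega -> R.
Hypothesis bF : forall i, bmfun (F i).
Variable M : 'I_d -> 'I_d -> complex_measure R (d.-tuple R).
Hypothesis FM : spectral_measure (correlation mu tau F) M.

Local Notation EX f := (Rintegral mu [set: Omega] f).
Local Notation Re_int i j f := (charge_Rintegral (re_part (M i j)) torus f).
Local Notation Im_int i j f := (charge_Rintegral (im_part (M i j)) torus f).
Local Notation K := (lazy_kernel tau).
Local Notation norm_const := ((2 * pi) ^- d : R).

Let mT := @measurable_torus d R.

Lemma correlation_inversion i j x : correlation mu tau F i j x =
  norm_const * (Re_int i j (fun q => cos (angle x q)) + Im_int i j (fun q => sin (angle x q))).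
Proof.
have := congr1 (@complex.Re R) (spectral_inversion FM i j x).
rewrite /complex_integral /character /= => ->; rewrite mul0r subr0.
have NE : Im_int i j (fun q => - sin (angle x q)) = - Im_int i j (fun q => sin (angle x q)).
  rewrite -mulN1r -charge_RintegralZ//; last exact: bmfun_sin.
  by apply: eq_charge_Rintegral => q; rewrite mulN1r.
transitivity (norm_const * (Re_int i j (fun q => cos (angle x q)) -
    Im_int i j (fun q => - sin (angle x q)))) => //.
by rewrite NE opprK.
Qed.

Lemma bmfun_iter_lazy (f : Omega -> R) n : bmfun f -> bmfun (iter n K f).
Proof. by move=> bf; elim: n => //= n; exact: (bmfun_lazy erg). Qed.

(** The induction needs all x together, since one application of the kernel mixes x with its
    neighbours, and needs the sine part, since off-diagonal entries may have an imaginary part. At x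
    = 0 the sines vanish. *)
Lemma spectral_iter_lazy i j n x :
  EX (fun w => F i w * iter n K (F j) (tau x w)) =
  norm_const * (Re_int i j (fun q => lazy_symbol q ^+ n * cos (angle x q)) +
                Im_int i j (fun q => lazy_symbol q ^+ n * sin (angle x q))).
Proof.
elim: n x => [|n IHn] x /=.
  rewrite -/(correlation mu tau F i j x) correlation_inversion.
  by congr (_ * (_ + _)); apply: eq_charge_Rintegral => q; rewrite expr0 mul1r.
set g := iter n K (F j) in IHn *.
have bg : bmfun g by exact: bmfun_iter_lazy.
have bgt y : bmfun (fun w => g (tau y w)) by exact: (bmfun_tau erg).
have bFg y := bmfunM (bF i) (bgt y).
have bs : bmfun (fun w => \sum_(k : direction d)
   (F i w * g (tau x w) - F i w * g (tau (x + step k) w))).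
  by apply: bmfun_sum => k; exact: bmfunB.
rewrite (EX_eq mu (g := fun w => F i w * g (tau x w) - @lazy_rate d R *
   \sum_(k : direction d) (F i w * g (tau x w) - F i w * g (tau (x + step k) w)))); last first.
  move=> w; rewrite /lazy_kernel mulrBr; congr (_ - _).
  rewrite [LHS]mulrCA; congr (_ * _); rewrite mulr_sumr; apply: eq_bigr => k _.
  by rewrite -(actionD erg) [step k + x]addrC mulrBr.
have bc := bmfun_cst (T := Omega) (@lazy_rate d R).
have bcs := bmfunM bc bs.
rewrite EXB// EXZ// EX_sum; last by move=> k; exact: bmfunB.
under eq_bigr do rewrite EXB// !IHn.
rewrite IHn.
have bk n' := bmfunX n' (@bmfun_lazy_symbol d R).
pose U (y : 'rV[int]_d) (q : d.-tuple R) := lazy_symbol q ^+ n * cos (angle y q) : R.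
pose V (y : 'rV[int]_d) (q : d.-tuple R) := lazy_symbol q ^+ n * sin (angle y q) : R.
have bU y : bmfun (U y) by apply: bmfunM => //; exact: bmfun_cos.
have bV y : bmfun (V y) by apply: bmfunM => //; exact: bmfun_sin.
have bcq := bmfun_cst (T := d.-tuple R) (@lazy_rate d R).
have step_charge (nu : {charge set (d.-tuple R) -> \bar R}) (W : 'rV[int]_d -> d.-tuple R -> R) :
    (forall y, bmfun (W y)) ->
    charge_Rintegral nu torus (fun q => W x q - @lazy_rate d R *
      \sum_(k : direction d) (W x q - W (x + step k) q)) =
    charge_Rintegral nu torus (W x) - @lazy_rate d R *
      \sum_(k : direction d) (charge_Rintegral nu torus (W x)
         - charge_Rintegral nu torus (W (x + step k))).
  move=> bW; have bsW : bmfun (fun q => \sum_(k : direction d) (W x q - W (x + step k) q)).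
    by apply: bmfun_sum => k; exact: bmfunB.
  have bcW := bmfunM bcq bsW.
  rewrite charge_RintegralB// charge_RintegralZ// charge_Rintegral_sum//; last first.
    by move=> k; exact: bmfunB.
  by congr (_ - _ * _); apply: eq_bigr => k _; rewrite charge_RintegralB.
have -> : Re_int i j (fun q => lazy_symbol q ^+ n.+1 * cos (angle x q)) =
    Re_int i j (U x) - @lazy_rate d R *
      \sum_(k : direction d) (Re_int i j (U x) - Re_int i j (U (x + step k))).
  rewrite -step_charge//; apply: eq_charge_Rintegral => q.
  rewrite exprSr -mulrA -lazy_symbol_cos mulrBr; congr (_ - _).
  rewrite [LHS]mulrCA; congr (_ * _); rewrite mulr_sumr; apply: eq_bigr => k _.
  by rewrite mulrBr.
have -> : Im_int i j (fun q => lazy_symbol q ^+ n.+1 * sin (angle x q)) =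
    Im_int i j (V x) - @lazy_rate d R *
      \sum_(k : direction d) (Im_int i j (V x) - Im_int i j (V (x + step k))).
  rewrite -step_charge//; apply: eq_charge_Rintegral => q.
  rewrite exprSr -mulrA -lazy_symbol_sin mulrBr; congr (_ - _).
  rewrite [LHS]mulrCA; congr (_ * _); rewrite mulr_sumr; apply: eq_bigr => k _.
  by rewrite mulrBr.
rewrite addrACA -opprD -mulrDr -big_split /= [RHS]mulrBr; congr (_ - _).
rewrite [RHS]mulrCA; congr (_ * _); rewrite mulr_sumr; apply: eq_bigr => k _.
by rewrite -/(U x) -/(V x) -/(U (x + step k)) -/(V (x + step k)); ring.
Qed.

Lemma spectral_autocorrelation i j n :
  EX (fun w => F i w * iter n K (F j) w) =
  norm_const * Re_int i j (fun q => lazy_symbol q ^+ n).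
Proof.
have := spectral_iter_lazy i j n 0.
rewrite (EX_eq mu (g := fun w => F i w * iter n K (F j) w)); last first.
  by move=> w; rewrite (action0 erg).
move=> ->; congr (_ * _).
rewrite [X in _ + X](_ : _ = 0) ?addr0.
  by apply: eq_charge_Rintegral => q; rewrite angle0 cos0 mulr1.
rewrite -[RHS](charge_Rintegral0 (im_part (M i j)) mT).
by apply: eq_charge_Rintegral => q; rewrite angle0 sin0 mulr0.
Qed.

Let re_fin i j A : measurable A -> re_part (M i j) A \is a fin_num.
Proof. by move=> mA; exact: fin_num_measure. Qed.

Lemma re_diag_ge0 i A : measurable A -> (0 <= re_part (M i i) A)%E.
Proof.
move=> mA; rewrite -(fineK (re_fin i i mA)) lee_fin.
have := spectral_psd FM (fun a => (a == i)%:R) mA.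
rewrite (bigD1 i)//= [X in _ + X]big1 ?addr0; last first.
  by move=> a ai; rewrite big1// => b _; rewrite (negPf ai) !mul0r.
rewrite (bigD1 i)//= big1 ?addr0; last first.
  by move=> a ai; rewrite (negPf ai) conjc0 mulr0 mul0r.
by rewrite eqxx conjc1 !mul1r lecE /= => /andP[].
Qed.

Lemma psd_pair i j (t : R[i]) A : i != j -> measurable A ->
  (0 <= complex_measure_val (M i i) A + conjc t * complex_measure_val (M i j) A
   + (t * complex_measure_val (M j i) A + t * conjc t * complex_measure_val (M j j) A))%R.
Proof.
move=> ij mA; have ji : (j == i) = false by rewrite eq_sym; exact: negPf.
pose z a : R[i] := if a == i then 1 else if a == j then t else 0.
have zi : z i = 1 by rewrite /z eqxx.
have zj : z j = t by rewrite /z ji eqxx.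
have z0 a : a != i -> a != j -> z a = 0 by rewrite /z => /negPf -> /negPf ->.
have := spectral_psd FM z mA.
rewrite (@big_two _ _ i j)//; last first.
  by move=> a ai aj; rewrite big1// => b _; rewrite z0// !mul0r.
rewrite (@big_two _ _ i j)//; last first.
  by move=> a ai aj; rewrite (z0 a)// conjc0 mulr0 mul0r.
rewrite (@big_two _ _ i j (fun b => z j * conjc (z b) * _))//; last first.
  by move=> a ai aj; rewrite (z0 a)// conjc0 mulr0 mul0r.
by rewrite zi zj conjc1 !mul1r mulr1.
Qed.

(** Positivity on e_i + t e_j. The values t = 1 and -1 bound the sum of the two off-diagonal real
    parts; t = i and -i have zero imaginary part, and comparing them shows that these real parts
    agree. *)
Lemma re_offdiag_le i j A : measurable A ->
  (re_part (M i j) A <= re_part (M i i) A + re_part (M j j) A)%E /\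
  (- re_part (M i j) A <= re_part (M i i) A + re_part (M j j) A)%E.
Proof.
move=> mA; have Mi0 := re_diag_ge0 i mA; have Mj0 := re_diag_ge0 j mA.
have [<-|ij] := eqVneq i j.
  split; first by rewrite leeDl.
  by rewrite (@le_trans _ _ 0%E) ?adde_ge0// leeNl oppe0.
have H1 := psd_pair 1 ij mA; have H2 := psd_pair (-1) ij mA.
have H3 := psd_pair 'i%C ij mA; have H4 := psd_pair (- 'i%C) ij mA.
move: H1 H2 H3 H4 Mi0 Mj0; rewrite /complex_measure_val.
rewrite -(fineK (re_fin i i mA)) -(fineK (re_fin j j mA)) -(fineK (re_fin i j mA)) -(fineK (re_fin j i mA)).
rewrite -EFinD -EFinN !lee_fin /=.
move: (fine (re_part (M i i) A)) (fine (re_part (M j j) A)) (fine (re_part (M i j) A)) (fine (re_part (M j i) A)).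
move: (fine (im_part (M i i) A)) (fine (im_part (M j j) A)) (fine (im_part (M i j) A)) (fine (im_part (M j i) A)).
move=> a1 a2 a3 a4 b1 b2 b3 b4.
rewrite !lecE /= => /andP[_ H1] /andP[_ H2] /andP[/eqP H3 _] /andP[/eqP H4 _] c1 c2.
have b34 : b3 = b4 by lra.
by split; lra.
Qed.

Lemma tilde_diag_ge0 i : (0 <= tilde M i i)%E.
Proof.
rewrite /tilde; have [m [_ ->]] := charge_integral_nonneg (@re_diag_ge0 i).
apply: integral_ge0 => q _; rewrite /inv_laplacian inve_ge0 lee_fin.
by apply: sumr_ge0 => m' _; rewrite subr_ge0 cos_le1.
Qed.

(** The factor from autocorrelation sums to [tilde]: twice the lazy rate comes from the geometric
    series for [inv_laplacian], and (2 pi)^d from Fourier inversion. *)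
Local Notation unit_const := (2 * @lazy_rate d R * (2 * pi) ^+ d : R).

Let unit_gt0 : 0 < unit_const.
Proof. by rewrite !mulr_gt0 ?lazy_rate_gt0// exprn_gt0// mulr_gt0// pi_gt0. Qed.

Let f (n : nat) (q : d.-tuple R) : R := 2 * @lazy_rate d R * lazy_symbol q ^+ n.

Let bf n : bmfun (f n).
Proof. by apply: bmfunM; [exact: bmfun_cst|apply: bmfunX; exact: bmfun_lazy_symbol]. Qed.

Let f_ge0 n q : 0 <= f n q.
Proof.
have /andP[k0 _] := lazy_symbol_bounds q.
by rewrite !mulr_ge0 ?exprn_ge0// ltW// lazy_rate_gt0.
Qed.

Let tildeE i j : tilde M i j = charge_integral (re_part (M i j)) torus
  (fun q => \sum_(n <oo) (f n q)%:E)%E.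
Proof. by congr charge_integral; apply/funext => q; exact: inv_laplacian_series. Qed.

Let Re_int_f i j n : Re_int i j (f n) =
  unit_const * EX (fun w => F i w * iter n K (F j) w).
Proof.
rewrite charge_RintegralZ//; last by apply: bmfunX; exact: bmfun_lazy_symbol.
rewrite spectral_autocorrelation [RHS]mulrA mulfK//.
by rewrite expf_neq0// mulf_neq0// gt_eqF// pi_gt0.
Qed.

Lemma tilde_diag_lty i B :
  (forall n, \sum_(m < n) EX (fun w => F i w * iter m K (F i) w) <= B) ->
  (tilde M i i < +oo)%E.
Proof.
move=> HB; rewrite tildeE; apply: (charge_integral_series_lty mT bf f_ge0 (B := unit_const * B)).
  by move=> A; exact: re_diag_ge0.
move=> n; under eq_bigr do rewrite Re_int_f.
by rewrite -mulr_sumr ler_pM2l.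
Qed.

Hypothesis diag_lty : forall i, (tilde M i i < +oo)%E.

(** Finite diagonal entries suffice, because the measure at (i, j) is dominated by the sum of the
    diagonal ones. *)
Lemma tilde_cvg i j : tilde M i j \is a fin_num /\
  (unit_const * \sum_(m < n) EX (fun w => F i w * iter m K (F j) w)) @[n --> \oo]
    --> fine (tilde M i j).
Proof.
have [] := @charge_integral_series_cvg _ _ _ (re_part (M i j)) _ mT f bf f_ge0
  (re_part (M i i)) (re_part (M j j)).
- by move=> A; exact: re_diag_ge0.
- by move=> A; exact: re_diag_ge0.
- by move=> A mA; have [] := re_offdiag_le i j mA.
- by move=> A mA; have [] := re_offdiag_le i j mA.
- by have := diag_lty i; rewrite tildeE.
- by have := diag_lty j; rewrite tildeE.
rewrite -tildeE => fin cv; split=> //.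
have -> // : (fun n => unit_const * \sum_(m < n) EX (fun w => F i w * iter m K (F j) w))
  = (fun n => \sum_(m < n) Re_int i j (f m)).
by apply/funext => n; rewrite mulr_sumr; apply: eq_bigr => m _; rewrite Re_int_f.
Qed.

Variable v : 'I_d -> R.
Let Fv (w : Omega) : R := \sum_(i < d) v i * F i w.

Let bFv : bmfun Fv.
Proof. by apply: bmfun_sum => i; apply: bmfunM => //; exact: bmfun_cst. Qed.

Lemma iter_lazy_sum m w : iter m K Fv w = \sum_(i < d) v i * iter m K (F i) w.
Proof.
have KE g u : K g u = g u - @lazy_rate d R *
    \sum_(k : direction d) (g u - g (tau (step k) u)) by [].
elim: m w => [//|m IHm] w /=; rewrite KE IHm.
under [X in _ - _ * X]eq_bigr do rewrite IHm -sumrB.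
rewrite exchange_big /= mulr_sumr -sumrB; apply: eq_bigr => i _.
rewrite KE [RHS]mulrBr; congr (_ - _); rewrite [RHS]mulrCA; congr (_ * _).
by rewrite mulr_sumr; apply: eq_bigr => k _; rewrite mulrBr.
Qed.

Lemma EX_autocorrelation_form m : EX (fun w => Fv w * iter m K Fv w) =
  \sum_(i < d) \sum_(j < d) v i * v j * EX (fun w => F i w * iter m K (F j) w).
Proof.
have bij i j : bmfun (fun w => F i w * iter m K (F j) w).
  by apply: bmfunM => //; exact: bmfun_iter_lazy.
have bvij i j : bmfun (fun w => v i * v j * (F i w * iter m K (F j) w)).
  by apply: bmfunM => //; exact: bmfun_cst.
rewrite (EX_eq mu (g := fun w => \sum_(i < d) \sum_(j < d)
   v i * v j * (F i w * iter m K (F j) w))); last first.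
  move=> w; rewrite iter_lazy_sum /Fv mulr_suml; apply: eq_bigr => i _.
  by rewrite mulr_sumr; apply: eq_bigr => j _; ring.
rewrite EX_sum; last by move=> i; apply: bmfun_sum => j.
apply: eq_bigr => i _; rewrite EX_sum//; apply: eq_bigr => j _.
by rewrite EXZ.
Qed.

Lemma tilde_form_cvg :
  (unit_const * \sum_(m < n) EX (fun w => Fv w * iter m K Fv w)) @[n --> \oo] -->
  \sum_(i < d) \sum_(j < d) v i * v j * fine (tilde M i j).
Proof.
have -> : (fun n => unit_const * \sum_(m < n) EX (fun w => Fv w * iter m K Fv w)) =
  (fun n => \sum_(i < d) \sum_(j < d) v i * v j *
     (unit_const * \sum_(m < n) EX (fun w => F i w * iter m K (F j) w))).
  apply/funext => n; under eq_bigr do rewrite EX_autocorrelation_form.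
  rewrite exchange_big /= mulr_sumr; apply: eq_bigr => i _.
  rewrite exchange_big /= mulr_sumr; apply: eq_bigr => j _.
  by rewrite -mulr_sumr mulrCA.
apply: cvg_big => [|i _]; first exact: add_continuous.
apply: cvg_big => [|j _]; first exact: add_continuous.
have [_ cv] := tilde_cvg i j.
exact: (cvgM (cvg_cst (v i * v j)) cv).
Qed.

(** The autocorrelations of v.F are nonnegative, so the partial sums increase to the quadratic form.
    The case n = 0 says that the form is nonnegative. *)
Lemma tilde_form_ge n : unit_const * \sum_(m < n) EX (fun w => Fv w * iter m K Fv w) <=
  \sum_(i < d) \sum_(j < d) v i * v j * fine (tilde M i j).
Proof.
have cv := tilde_form_cvg.
rewrite -(cvg_lim _ cv)//.
apply: (@nondecreasing_cvgn_le _ (fun n => unit_const * \sum_(m < n) EX (fun w => Fv w * iter m K Fv w))).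
  apply/nondecreasing_seqP => m; rewrite ler_pM2l// big_ord_recr /= lerDl.
  exact: (EX_autocorrelation_ge0 erg).
by apply/cvg_ex; eexists; exact: cv.
Qed.

End SpectralRepresentation.

(** * Annealed bounds *)

Section LimitBounds.
Local Open Scope ereal_scope.
Context {R : realType}.
Variables (f : R -> \bar R) (F : set_system R).
Hypothesis FF : ProperFilter F.

Lemma limf_einf_le_esup : limf_einf f F <= limf_esup f F.
Proof.
rewrite limf_einfE limf_esupE; apply: ge_ereal_sup => _ [V FV <-].
apply: le_ereal_inf_tmp => _ [W FW <-].
have [x [Vx Wx]] := filter_ex (filterI FV FW).
apply: (@le_trans _ _ (f x)).
  by apply: ge_ereal_inf; exists (f x) => //; exists x.
by apply: le_ereal_sup_tmp; exists (f x) => //; exists x.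
Qed.

Lemma limf_esup_le (b : \bar R) : (\forall x \near F, f x <= b) -> limf_esup f F <= b.
Proof.
move=> Fb; rewrite limf_esupE; apply: ge_ereal_inf.
exists (ereal_sup [set f x | x in [set x | f x <= b]]); first by exists [set x | f x <= b].
by apply: ge_ereal_sup => _ [x fx <-].
Qed.

Lemma limf_einf_ge (b : \bar R) : (\forall x \near F, b <= f x) -> b <= limf_einf f F.
Proof.
move=> Fb; rewrite limf_einfE; apply: le_ereal_sup_tmp.
exists (ereal_inf [set f x | x in [set x | b <= f x]]); first by exists [set x | b <= f x].
by apply: le_ereal_inf_tmp => _ [x fx <-].
Qed.

End LimitBounds.

(** * From discrete moments to continuous time *)

Section AnnealedSecondMoment.
Context {d : nat} {R : realType} {dO dT : measure_display}.
Context {Omega : measurableType dO} {T : measurableType dT}.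
Variables (mu : probability Omega R) (tau : 'rV[int]_d -> Omega -> Omega).
Hypothesis erg : ergodic_action mu tau.
Variables (p : direction d -> Omega -> R) (s_up : R).
Hypothesis p_meas : forall k, measurable_fun [set: Omega] (p k).
Hypothesis p_bounded : forall k w, 0 <= p k w <= s_up.
Variables (Pw : R.-pker Omega ~> T) (X : R -> T -> 'rV[int]_d).
Hypothesis X_walk : random_walk tau p Pw X.
Variable v : 'rV[R]_d.

Local Notation EX f := (Rintegral mu [set: Omega] f).
Local Notation moment L n := (moments tau p v L n).2.
Local Notation msd t := (annealed mu Pw (fun a => dotZ v (X t a) ^+ 2)).

Section Rate.
Variable L : R.
Hypothesis L_gt0 : 0 < L.
Hypothesis L_big : s_up * (2 * d%:R) <= L.

Lemma annealed_moment t : 0 <= t ->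
  (msd t = \sum_(n <oo) (poisson (L * t) n * EX (moment L n))%:E)%E.
Proof.
move=> t0; have Lt0 : 0 <= L * t by rewrite mulr_ge0// ltW.
have bc n : bmfun (moment L n) := (bmfun_moments erg p_meas p_bounded v L n).2.
have c0 n w : 0 <= moment L n w := moment_ge0 erg p_bounded v n w L_gt0 L_big.
rewrite /annealed.
under eq_integral => w _.
  rewrite (chain_expectation (X_walk w) (r := fun k y => p k (tau y w))
    (s := fun (k : direction d) y => y + step k) (L := L) (F := fun y => dotZ v y ^+ 2))//; last 3 first.
  - by move=> k x; case/andP: (p_bounded k (tau x w)).
  - by move=> x; apply: le_trans (rate_sum_le p_bounded _) L_big.
  - by move=> x; exact: sqr_ge0.
  under eq_eseriesr => n _.
    rewrite (iter_jump_kernel_moments erg) (action0 erg).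
    have -> : dotZ v (0 : 'rV[int]_d) = 0.
      by rewrite /dotZ big1// => i _; rewrite mxE mulr0.
    rewrite expr0n mulr0 mul0r !add0r; over.
  over.
have bpc n : bmfun (fun w => poisson (L * t) n * moment L n w).
  by apply: bmfunM => //; exact: bmfun_cst.
rewrite (integral_series_bmfun mu measurableT bpc); last first.
  by move=> n w; rewrite mulr_ge0// poisson_ge0.
by apply: eq_eseriesr => n _; rewrite EXZ.
Qed.

(** The number of uniformized steps by time t has mean L t, so a bound n U / L on the discrete
    moments becomes t U, free of L. *)
Lemma annealed_le t U : 0 <= t ->
  (forall n, EX (moment L n) <= n%:R * (L^-1 * U)) -> (msd t <= (t * U)%:E)%E.
Proof.
move=> t0 HU; have Lt0 : 0 <= L * t by rewrite mulr_ge0// ltW.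
have c0 n w : 0 <= moment L n w := moment_ge0 erg p_bounded v n w L_gt0 L_big.
have -> : (t * U)%:E = (\sum_(n <oo) ((L^-1 * U)%:E * (n%:R * poisson (L * t) n)%:E))%E.
  rewrite nneseriesZl; last by move=> n _; rewrite lee_fin mulr_ge0// poisson_ge0.
  by rewrite poisson_mean// -EFinM; congr EFin; field; rewrite gt_eqF.
rewrite annealed_moment//; apply: lee_nneseries => n _.
  by move=> _; rewrite lee_fin mulr_ge0 ?poisson_ge0// EX_ge0.
rewrite -EFinM lee_fin [leRHS](_ : _ = poisson (L * t) n * (n%:R * (L^-1 * U))); last by ring.
by rewrite ler_wpM2l// poisson_ge0.
Qed.

Lemma annealed_ge t B : 0 <= t -> 0 <= B ->
  (forall n, n%:R * (L^-1 * B) <= EX (moment L n)) -> ((t * B)%:E <= msd t)%E.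
Proof.
move=> t0 B0 HB; have Lt0 : 0 <= L * t by rewrite mulr_ge0// ltW.
have -> : (t * B)%:E = (\sum_(n <oo) ((L^-1 * B)%:E * (n%:R * poisson (L * t) n)%:E))%E.
  rewrite nneseriesZl; last by move=> n _; rewrite lee_fin mulr_ge0// poisson_ge0.
  by rewrite poisson_mean// -EFinM; congr EFin; field; rewrite gt_eqF.
rewrite annealed_moment//; apply: lee_nneseries => n _.
  move=> _; rewrite -EFinM lee_fin; apply: mulr_ge0.
    by rewrite mulr_ge0// invr_ge0 ltW.
  by rewrite mulr_ge0// poisson_ge0.
rewrite -EFinM lee_fin [leLHS](_ : _ = poisson (L * t) n * (n%:R * (L^-1 * B))); last by ring.
by rewrite ler_wpM2l// poisson_ge0.
Qed.

End Rate.
End AnnealedSecondMoment.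

(** * The dual norm of a conductance gradient *)

Section GradientBound.
Context {d : nat} {R : realType} {dO : measure_display}.
Context {Omega : measurableType dO}.
Variables (mu : probability Omega R) (tau : 'rV[int]_d -> Omega -> Omega).
Hypothesis erg : ergodic_action mu tau.
Variables (p : direction d -> Omega -> R) (s_up : R).
Hypothesis p_meas : forall k, measurable_fun [set: Omega] (p k).
Hypothesis p_bounded : forall k w, 0 <= p k w <= s_up.

Local Notation EX f := (Rintegral mu [set: Omega] f).
Local Notation K := (lazy_kernel tau).

Lemma bmfun_conductance k : bmfun (conductance tau p k).
Proof.
have bp := bmfun_rate p_meas p_bounded.
apply: bmfunM; first exact: bmfun_cst.
by apply: bmfunD => //; exact: (bmfun_tau erg).
Qed.

Lemma bmfun_flow k : bmfun (flow tau p k).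
Proof.
have bp := bmfun_rate p_meas p_bounded.
apply: bmfunM; first exact: bmfun_cst.
by apply: bmfunB => //; exact: (bmfun_tau erg).
Qed.

Lemma EX_cauchy_schwarz (f g : Omega -> R) : bmfun f -> bmfun g ->
  EX (fun w => f w * g w) ^+ 2 <= EX (fun w => f w ^+ 2) * EX (fun w => g w ^+ 2).
Proof.
move=> bf bg; apply: discriminant_le => [|x].
  by apply: EX_ge0 => w; exact: sqr_ge0.
have bf2 := bmfunX 2 bf; have bg2 := bmfunX 2 bg; have bfg := bmfunM bf bg.
have b2x := bmfun_cst (T := Omega) (2 * x); have bx := bmfun_cst (T := Omega) (x ^+ 2).
have bxg := bmfunM bx bg2; have bxf := bmfunM b2x bfg; have b1 := bmfunD bf2 bxf.
rewrite -!EXZ// -EXD// -EXD//; apply: EX_ge0 => w.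
have -> : f w ^+ 2 + 2 * x * (f w * g w) + x ^+ 2 * g w ^+ 2 = (f w + x * g w) ^+ 2 by ring.
exact: sqr_ge0.
Qed.

Lemma conductance_opp k w :
  conductance tau p (opp_dir k) w = conductance tau p k (tau (step (opp_dir k)) w).
Proof.
rewrite /conductance opp_dirK -(actionD erg) step_opp subrr (action0 erg).
by rewrite addrC.
Qed.

(* The conductance field pairs with an antisymmetric edge function only
   through the gradient of the test function. *)
Lemma EX_conductance_gradient (a : direction d -> R) g : bmfun g ->
  (forall k, a (opp_dir k) = - a k) ->
  EX (fun w => (\sum_(k : direction d) a k * conductance tau p k w) * g w) ^+ 2 <=
  (\sum_(k : direction d) a k ^+ 2) * (2 * d%:R) * s_up ^+ 2 / (2 * @lazy_rate d R) *
    EX (fun w => g w * (g w - K g w)).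
Proof.
move=> bg ha; have bs := bmfun_conductance; have bgt k := bmfun_tau erg (step k) bg.
pose y k := EX (fun w => conductance tau p k w * (g (tau (step k) w) - g w)).
have bd k : bmfun (fun w => g (tau (step k) w) - g w) by exact: bmfunB.
have bsd k := bmfunM (bs k) (bd k); have bsg k := bmfunM (bs k) bg.
have E1 : EX (fun w => (\sum_(k : direction d) a k * conductance tau p k w) * g w) =
    \sum_(k : direction d) a k * EX (fun w => conductance tau p k w * g w).
  rewrite (EX_eq mu (g := fun w => \sum_(k : direction d) a k * (conductance tau p k w * g w))); last first.
    by move=> w; rewrite mulr_suml; apply: eq_bigr => k _; rewrite mulrA.
  rewrite EX_sum; last by move=> k; apply: bmfunM => //; exact: bmfun_cst.
  by apply: eq_bigr => k _; rewrite EXZ.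
have E2 k : EX (fun w => conductance tau p (opp_dir k) w * g w) =
    EX (fun w => conductance tau p k w * g (tau (step k) w)).
  rewrite (EX_eq mu (g := fun w => conductance tau p k (tau (step (opp_dir k)) w) * g w)).
    by rewrite (EX_tauM erg)// step_opp opprK.
  by move=> w; rewrite conductance_opp.
have E3 : \sum_(k : direction d) a k * EX (fun w => conductance tau p k w * g w) =
    - (2^-1 * \sum_(k : direction d) a k * y k).
  (* Reversing every bond flips the sign of [a] and moves g to the other endpoint; averaging the two
     expressions produces the gradient of g. *)
  have S : \sum_(k : direction d) a k * EX (fun w => conductance tau p k w * g w) =
     - \sum_(k : direction d) a k * EX (fun w => conductance tau p k w * g (tau (step k) w)).
    rewrite reindex_opp_dir -sumrN; apply: eq_bigr => k _.
    by rewrite ha E2 mulNr.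
  have Y : \sum_(k : direction d) a k * y k =
     \sum_(k : direction d) a k * EX (fun w => conductance tau p k w * g (tau (step k) w)) -
     \sum_(k : direction d) a k * EX (fun w => conductance tau p k w * g w).
    rewrite -sumrB; apply: eq_bigr => k _; rewrite -mulrBr -EXB//; last exact: bmfunM.
    by congr (_ * _); apply: EX_eq => w; rewrite mulrBr.
  by rewrite Y; move: S; lra.
rewrite E1 E3 sqrrN exprMn.
have A0 : 0 <= \sum_(k : direction d) a k ^+ 2 by apply: sumr_ge0 => k _; exact: sqr_ge0.
set A := \sum_(k : direction d) a k ^+ 2 in A0 *.
have aA k : a k ^+ 2 <= A.
  by rewrite /A (bigD1 k)//= lerDl sumr_ge0// => l _; exact: sqr_ge0.
have y2 k : y k ^+ 2 <= s_up ^+ 2 * EX (fun w => (g (tau (step k) w) - g w) ^+ 2).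
  apply: le_trans (EX_cauchy_schwarz (bs k) (bd k)) _.
  apply: ler_wpM2r; first by apply: EX_ge0 => w; exact: sqr_ge0.
  rewrite -(EX_cst mu (s_up ^+ 2)); apply: EX_le => [||w].
  - exact: bmfunX.
  - exact: bmfun_cst.
  have /andP[p0 p1] := p_bounded k w.
  have /andP[q0 q1] := p_bounded (opp_dir k) (tau (step k) w).
  by rewrite ler_pXn2r// /conductance ?nnegrE; lra.
have W := weighted_sqr_le (q := fun=> 1) (fun k => a k * y k) (fun _ => ler01).
have -> : \sum_(k : direction d) a k * y k = \sum_(k : direction d) 1 * (a k * y k).
  by apply: eq_bigr => k _; rewrite mul1r.
rewrite (EX_lazy_energy erg)//.
set D := \sum_(k : direction d) EX (fun w => (g (tau (step k) w) - g w) ^+ 2).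
have D0 : 0 <= D by apply: sumr_ge0 => k _; apply: EX_ge0 => w; exact: sqr_ge0.
have W2 : \sum_(k : direction d) 1 * (a k * y k) ^+ 2 <= A * (s_up ^+ 2 * D).
  rewrite /D mulr_sumr mulr_sumr; apply: ler_sum => k _.
  by rewrite mul1r exprMn ler_pM ?sqr_ge0.
have N : \sum_(k : direction d) (1 : R) = 2 * d%:R.
  by rewrite sumr_const card_prod card_ord card_bool natrM mulrC.
rewrite N in W.
have c0 := @lazy_rate_gt0 d R.
(* The factor 1/4 is the square of the 1/2 from averaging over bond reversal, and 2 d counts
   directions in Cauchy-Schwarz. *)
have -> : A * (2 * d%:R) * s_up ^+ 2 / (2 * @lazy_rate d R) * (@lazy_rate d R / 2 * D) =
   4^-1 * ((2 * d%:R) * (A * (s_up ^+ 2 * D))) by field; rewrite gt_eqF.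
have -> : (2^-1 : R) ^+ 2 = 4^-1 by field.
rewrite ler_pM2l//; apply: le_trans W _.
by rewrite ler_wpM2l// mulr_ge0.
Qed.

End GradientBound.

Theorem proposition1 (d : nat) (R : realType) (dO dT : measure_display)
    (Omega : measurableType dO) (T : measurableType dT)
    (mu : probability Omega R) (tau : 'rV[int]_d -> Omega -> Omega)
    (p : direction d -> Omega -> R) (s_up s_low : R)
    (Pw : R.-pker Omega ~> T) (X : R -> T -> 'rV[int]_d)
    (Chat Dhat : 'I_d -> 'I_d -> complex_measure R (d.-tuple R))
    (tau_ergodic : ergodic_action mu tau)
    (p_measurable : forall k, measurable_fun [set: Omega] (p k))
    (p_bounded : forall k w, 0 <= p k w <= s_up)
    (X_walk : random_walk tau p Pw X)
    (Chat_spectral : spectral_measure (correlation mu tau (phi tau p)) Chat)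
    (Dhat_spectral : spectral_measure (correlation mu tau (psi tau p)) Dhat)
    (bistochastic : {ae mu, forall w,
       \sum_(k : direction d) p k w
         = \sum_(k : direction d) p (opp_dir k) (tau (step k) w)})
    (no_drift : forall k, Rintegral mu [set: Omega] (flow tau p k) = 0)
    (s_low_range : 0 < s_low <= s_up)
    (elliptic : {ae mu, forall w, forall k, s_low <= conductance tau p k w})
    (h_minus_1 : (\sum_(i < d) tilde Chat i i < +oo)%E)
    (v : 'rV[R]_d) :
  let msd (t : R) : \bar R :=
    ((t^-1)%:E * annealed mu Pw (fun a => dotZ v (X t a) ^+ 2)%R)%E in
  let norm2 : R := \sum_(i < d) v 0 i ^+ 2 in
  [/\ ((2 * s_low * norm2)%:E <= limf_einf msd +oo%R)%E,
      (limf_einf msd +oo%R <= limf_esup msd +oo%R)%E &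
      (limf_esup msd +oo%R <= (6 * s_up * norm2)%:E
         + (24 / s_low)%:E
           * \sum_(i < d) \sum_(j < d)
               (tilde Chat i j + tilde Dhat i j) * (v 0 i * v 0 j)%:E)%E].
Proof.
move=> msd norm2; have /andP[s_low0 s_low_le] := s_low_range.
have s_up0 : 0 < s_up by exact: lt_le_trans s_low_le.
have norm2_ge0 : 0 <= norm2 by apply: sumr_ge0 => i _; exact: sqr_ge0.
pose A : R := s_up * (2 * d%:R).
have A0 : 0 <= A by rewrite mulr_ge0 ?(ltW s_up0)// mulr_ge0.
have c0 := @lazy_rate_gt0 d R.
have near_pos : \forall t \near +oo%R, 0 < t :> R by apply: nbhs_pinfty_gt; exact: num_real.
have bphi i : bmfun (phi tau p i).
  apply: bmfun_sum => k; apply: bmfunM; first exact: bmfun_cst.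
  exact: (bmfun_flow tau_ergodic p_measurable p_bounded).
have bpsi i : bmfun (psi tau p i).
  apply: bmfun_sum => k; apply: bmfunM; first exact: bmfun_cst.
  exact: (bmfun_conductance tau_ergodic p_measurable p_bounded).
have Cfin i : (tilde Chat i i < +oo)%E.
  apply: le_lt_trans h_minus_1; rewrite (bigD1 i)//= leeDl// sume_ge0// => j _.
  exact: (tilde_diag_ge0 Chat_spectral).
have step_antisym i (k : direction d) :
    (step (opp_dir k) 0 i)%:~R = - (step k 0 i)%:~R :> R.
  by rewrite step_opp mxE mulrNz.
(* Finiteness comes from psi being a gradient: its i-th component pairs the conductances with the
   antisymmetric function k -> k_i. *)
have Dfin i : (tilde Dhat i i < +oo)%E.
  pose N := (\sum_(k : direction d) ((step k 0 i)%:~R : R) ^+ 2) * (2 * d%:R)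
    * s_up ^+ 2 / (2 * @lazy_rate d R).
  apply: (tilde_diag_lty tau_ergodic bpsi Dhat_spectral (B := N)) => n.
  apply: (EX_autocorrelation_sum_le tau_ergodic) => // [|g bg].
    rewrite divr_ge0 ?mulr_ge0 ?exprn_ge0 ?(ltW c0) ?(ltW s_up0)//.
    by apply: sumr_ge0 => k _; exact: sqr_ge0.
  exact: (EX_conductance_gradient tau_ergodic p_measurable p_bounded bg (step_antisym i)).
pose form M := \sum_(i < d) \sum_(j < d) v 0 i * v 0 j * fine (tilde M i j) : R.
have formE : (\sum_(i < d) \sum_(j < d)
    (tilde Chat i j + tilde Dhat i j) * (v 0 i * v 0 j)%:E = (form Chat + form Dhat)%:E)%E.
  rewrite -big_split /= -sumEFin; apply: eq_bigr => i _.
  rewrite -big_split /= -sumEFin; apply: eq_bigr => j _.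
  have [cfin _] := tilde_cvg tau_ergodic bphi Chat_spectral Cfin i j.
  have [dfin _] := tilde_cvg tau_ergodic bpsi Dhat_spectral Dfin i j.
  rewrite -(fineK cfin) -(fineK dfin) -EFinD -EFinM; congr EFin; ring.
have formD0 : 0 <= form Dhat.
  have := tilde_form_ge tau_ergodic bpsi Dhat_spectral Dfin (fun i => v 0 i) 0.
  by rewrite big_ord0 mulr0.
have formC0 : 0 <= form Chat.
  have := tilde_form_ge tau_ergodic bphi Chat_spectral Cfin (fun i => v 0 i) 0.
  by rewrite big_ord0 mulr0.
have currentE : current tau p v = fun w => \sum_(i < d) v 0 i * phi tau p i w.
  apply/funext => w; rewrite /current /phi.
  under [RHS]eq_bigr do rewrite mulr_sumr.
  rewrite exchange_big /=; apply: eq_bigr => k _.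
  by rewrite /dotZ mulr_suml; apply: eq_bigr => i _; rewrite -mulrA.
pose unit_const : R := 2 * @lazy_rate d R * (2 * pi) ^+ d.
have twopi : 1 <= (2 * pi) ^+ d :> R.
  by rewrite exprn_ege1//; have := pi_ge2 R; lra.
have unit0 : 0 < unit_const by rewrite !mulr_gt0// (lt_le_trans ltr01).
(* The spectral bound gives [form Chat / unit_const] for the lazy energy, and the comparison with
   the Dirichlet form multiplies it by the lazy rate over [s_low]. *)
pose N := form Chat / (2 * (2 * pi) ^+ d * s_low).
have N0 : 0 <= N by rewrite divr_ge0// !mulr_ge0 ?(ltW s_low0)// (le_trans ler01).
have bcur : bmfun (current tau p v).
  exact: (bmfun_current tau_ergodic p_measurable p_bounded).
have current_bound h : bmfun h ->
    Rintegral mu [set: Omega] (fun w => current tau p v w * h w) ^+ 2 <= N * dirichlet mu tau p h.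
  move=> bh.
  have le1 := EX_spectral_bound tau_ergodic bcur bh (N := form Chat / unit_const).
  have le2 := dirichlet_lazy_le tau_ergodic p_measurable p_bounded elliptic bh.
  apply: le_trans (le1 _) _ => [n|].
    rewrite ler_pdivlMr// mulrC currentE.
    exact: (tilde_form_ge tau_ergodic bphi Chat_spectral Cfin (fun i => v 0 i)).
  have -> : N * dirichlet mu tau p h =
      form Chat / unit_const * (@lazy_rate d R * dirichlet mu tau p h / s_low).
    rewrite /N /unit_const; field.
    by rewrite !gt_eqF// (lt_le_trans ltr01).
  rewrite ler_wpM2l ?divr_ge0 ?(ltW unit0)//.
  by rewrite ler_pdivlMr// mulrC.
split.
- apply: limf_einf_ge; apply: filterS near_pos => t t0.
  apply/lee_addgt0Pr => e e0; pose B := 2 * s_low * norm2.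
  have B0 : 0 <= B by rewrite !mulr_ge0// ltW.
  (* L is chosen after e: the last summand makes the loss A B / L at most e, and the others ensure L
     > 0 and A <= L. *)
  pose L := A + 1 + A * B / e.
  have ABe : 0 <= A * B / e by rewrite divr_ge0 ?mulr_ge0// ltW.
  have L0 : 0 < L by rewrite /L; lra.
  have LA : A <= L by rewrite /L; lra.
  have r0 : 0 <= 1 - L^-1 * A by rewrite subr_ge0 mulrC ler_pdivrMr// mul1r.
  have low : ((t * ((1 - L^-1 * A) * B))%:E <= annealed mu Pw (fun a => dotZ v (X t a) ^+ 2)%R)%E.
    apply: (annealed_ge tau_ergodic p_measurable p_bounded X_walk L0 LA) => [||n].
    - exact: ltW.
    - exact: mulr_ge0.
    - rewrite [L^-1 * (_ * B)]mulrA.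
      exact: (EX_moment_lower tau_ergodic p_measurable p_bounded bistochastic v elliptic n L0 LA (ltW s_low0)).
  apply: (@le_trans _ _ (((1 - L^-1 * A) * B)%:E + e%:E)%E).
    rewrite -EFinD lee_fin -/B.
    have : L^-1 * (A * B) <= e.
      rewrite mulrC ler_pdivrMr// /L mulrDr [e * (_ / e)]mulrC divfK ?gt_eqF//.
      by rewrite lerDr mulr_ge0 ?addr_ge0// ltW.
    lra.
  rewrite leeD2r// /msd -[leLHS](_ : ((t^-1)%:E * (t * ((1 - L^-1 * A) * B))%:E)%E = _); last first.
    by rewrite -EFinM mulrA mulVf ?gt_eqF// mul1r.
  by rewrite lee_wpmul2l// lee_fin invr_ge0 ltW.
- exact: limf_einf_le_esup.
- apply: limf_esup_le; apply: filterS near_pos => t t0.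
  pose L := 4 * A + 1; have L0 : 0 < L by rewrite /L; lra.
  have LA : 4 * A <= L by rewrite /L; lra.
  have LA' : A <= L by rewrite /L; lra.
  pose U := 3 * s_up * norm2 + 4 * N.
  have upp : (annealed mu Pw (fun a => dotZ v (X t a) ^+ 2)%R <= (t * U)%:E)%E.
    apply: (annealed_le tau_ergodic p_measurable p_bounded X_walk L0 LA') => [|n]; first exact: ltW.
    exact: (EX_moment_upper tau_ergodic p_measurable p_bounded bistochastic).
  apply: (@le_trans _ _ U%:E).
    rewrite -[leRHS](_ : ((t^-1)%:E * (t * U)%:E)%E = _); last first.
      by rewrite -EFinM mulrA mulVf ?gt_eqF// mul1r.
    by rewrite lee_wpmul2l// lee_fin invr_ge0 ltW.
  rewrite formE -EFinM -EFinD lee_fin /U.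
  (* Since (2 pi)^d >= 1, 4 N is at most 2 / s_low times the form of [Chat]. *)
  have NE : 4 * N <= 24 / s_low * form Chat.
    rewrite /N; have -> : 4 * (form Chat / (2 * (2 * pi) ^+ d * s_low)) =
      2 / s_low * form Chat * ((2 * pi) ^+ d)^-1.
      by field; rewrite !gt_eqF// (lt_le_trans ltr01).
    apply: (@le_trans _ _ (2 / s_low * form Chat)).
      by rewrite ler_piMr ?mulr_ge0 ?invr_ge0 ?(ltW s_low0)// invf_le1// (lt_le_trans ltr01).
    by rewrite ler_wpM2r// ler_pM2r ?invr_gt0// ler_nat.
  have : 0 <= 24 / s_low * form Dhat by rewrite mulr_ge0// divr_ge0// ltW.
  have : 0 <= s_up * norm2 by rewrite mulr_ge0// ltW.
  move: NE; lra.
Qed.
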